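(* Let $(X,\mathfrak B,\mu)$ be a standard non-atomic probability space and let $T=(T_t)_{t\in\mathbb R}$ be an ergodic free $\mu$-preserving flow on it. Let $I(T)=\{s\in\mathbb R^*: T\circ s\text{ is isomorphic to }T\}$ and $E(T)=\{t\in\mathbb R^*: T_t\text{ is isomorphic to }T_1\}$. Then: (i) $I(T)$ and $E(T)$ are Borel subsets of $\mathbb R^*$. (ii) There is a topology $\tau$ on $I(T)$ which is stronger (finer) than the topology induced from $\mathbb R^*$ and such that $(I(T),\tau)$ is a Polish topological group.
   Context: $\mathbb R^*=\mathbb R\setminus\{0\}$ is the multiplicative group of non-zero reals. A $\mu$-preserving flow is a measurable action $T=(T_t)_{t\in\mathbb R}$ of $\mathbb R$ by invertible $\mu$-preserving transformations. For $s\in\mathbb R^*$, $T\circ s$ denotes the flow $(T_{st})_{t\in\mathbb R}$. Flows $T,T'$ on $(X,\mu)$ are isomorphic if there is an invertible $\mu$-preserving transformation $R$ of $X$ with $RT_tR^{-1}=T'_t$ for all $t\in\mathbb R$; transformations $T_t$ and $T_1$ are isomorphic if $RT_1R^{-1}=T_t$ for some such $R$. Transformations are identified if they agree $\mu$-almost everywhere. The set $I(T)$ is a multiplicative subgroup of $\mathbb R^*$. *)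

(* Defs.v *)
From HB Require Import structures.
From mathcomp Require Import all_boot all_order all_algebra.
From mathcomp Require Import all_classical all_reals all_analysis.
From mathcomp Require Import measurable_realfun.

Set Implicit Arguments.
Unset Strict Implicit.
Unset Printing Implicit Defensive.

Import Order.TTheory GRing.Theory Num.Theory.
Import numFieldNormedType.Exports.

Local Open Scope classical_set_scope.
Local Open Scope ring_scope.

Section topology.

Definition separable_space (S : topologicalType) :=
  exists2 D : set S, countable D & dense D.

Definition complete_metric (R : realType) (M : metricType R) :=
  forall F : set_system M, ProperFilter F -> cauchy F -> exists l : M, F --> l.

Definition homeomorphic (S S' : topologicalType) :=
  exists (f : S -> S') (g : S' -> S),
    [/\ cancel f g, cancel g f, continuous f & continuous g].

Definition polish_space (R : realType) (S : topologicalType) :=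
  separable_space S /\
  exists M : metricType R, complete_metric M /\ homeomorphic S M.

Definition borel (S : topologicalType) : set (set S) := <<s @open S >>.

(* A topology on a type [S] is an element of [Topological.axioms_ S]; packing
   it gives a topological space with carrier [S] without interfering with a
   topology that [S] may already be canonically equipped with. *)
Definition topology (S : Type) := Topological.axioms_ S.

Definition with_topology (S : Type) (tau : topology S) : topologicalType :=
  Topological.Pack tau.

Definition finer_topology (S : topologicalType) (tau : topology S) :=
  forall U : set S, open U -> @open (with_topology tau) U.

Definition group_topology (G : groupType) (tau : topology G) :=
  let Gtau := with_topology tau in
  continuous (fun z : Gtau * Gtau => ((z.1 : G) * (z.2 : G))%g : Gtau) /\
  continuous (fun x : Gtau => ((x : G)^-1)%g : Gtau).

End topology.

Arguments borel : clear implicits.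

Section Rstar.
Variable R : realType.

(* As a [set_type], it carries the topology induced from [R]. *)
Definition Rstar := set_type [set x : R | x != 0].

HB.instance Definition _ := Topological.on Rstar.

Lemma Rstar_neq0 (x : Rstar) : val x != 0.
Proof. exact: set_valP x. Qed.

Definition mkRstar (x : R) (x0 : x != 0) : Rstar := exist _ x (mem_set x0).

Definition Rstar_one : Rstar := mkRstar (oner_neq0 R).

Definition Rstar_mul (x y : Rstar) : Rstar :=
  mkRstar (mulf_neq0 (Rstar_neq0 x) (Rstar_neq0 y)).

Definition Rstar_inv (x : Rstar) : Rstar :=
  mkRstar (invr_neq0 (Rstar_neq0 x)).

Fact Rstar_mulA : associative Rstar_mul.
Proof. by move=> x y z; apply: val_inj; rewrite /= mulrA. Qed.

Fact Rstar_mul1 : left_id Rstar_one Rstar_mul.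
Proof. by move=> x; apply: val_inj; rewrite /= mul1r. Qed.

Fact Rstar_mul1r : right_id Rstar_one Rstar_mul.
Proof. by move=> x; apply: val_inj; rewrite /= mulr1. Qed.

Fact Rstar_mulV : left_inverse Rstar_one Rstar_inv Rstar_mul.
Proof. by move=> x; apply: val_inj; rewrite /= mulVf// Rstar_neq0. Qed.

Fact Rstar_mulrV : right_inverse Rstar_one Rstar_inv Rstar_mul.
Proof. by move=> x; apply: val_inj; rewrite /= mulfV// Rstar_neq0. Qed.

HB.instance Definition _ := isGroup.Build Rstar
  Rstar_mulA Rstar_mul1 Rstar_mul1r Rstar_mulV Rstar_mulrV.

End Rstar.

Section probability_space.
Context {d : measure_display} {X : measurableType d} {R : realType}.
Variable P : probability X R.

Definition standard_borel :=
  exists tau : topology X,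
    polish_space R (with_topology tau) /\
    (@measurable d X : set (set X)) = borel (with_topology tau).

Definition nonatomic := forall A : set X, measurable A -> (0 < P A)%E ->
  exists B : set X, [/\ measurable B, B `<=` A, (0 < P B)%E & (P B < P A)%E].

Definition preserves (f : X -> X) :=
  forall A : set X, measurable A -> P (f @^-1` A) = P A.

(* Invertibility is understood modulo null sets. *)
Record automorphism := Automorphism {
  aut_fun :> X -> X;
  aut_inv : X -> X;
  measurable_aut : measurable_fun setT aut_fun;
  measurable_aut_inv : measurable_fun setT aut_inv;
  aut_preserves : preserves aut_fun;
  aut_funK : \forall x \ae P, aut_inv (aut_fun x) = x;
  aut_invK : \forall x \ae P, aut_fun (aut_inv x) = x }.

Record flow := Flow {
  flow_fun :> R -> X -> X;
  measurable_flow : measurable_fun [set: R * X] (fun z => flow_fun z.1 z.2);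
  flow0 : forall x, flow_fun 0 x = x;
  flowD : forall s t x, flow_fun (s + t) x = flow_fun s (flow_fun t x);
  flow_preserves : forall t, preserves (flow_fun t) }.

Definition ergodic_flow (T : flow) := forall A : set X, measurable A ->
  (forall t, T t @^-1` A = A) -> P A = 0%E \/ P A = 1%E.

Definition free_flow (T : flow) :=
  \forall x \ae P, forall t, T t x = x -> t = 0.

(* S f S^-1 = g almost everywhere *)
Definition conjugates (S : automorphism) (f g : X -> X) :=
  \forall x \ae P, S (f (aut_inv S x)) = g x.

Definition isomorphic (f g : X -> X) :=
  exists S : automorphism, conjugates S f g.

Definition flow_isomorphic (T T' : flow) :=
  exists S : automorphism, forall t, conjugates S (T t) (T' t).

Section rescale.
Variables (T : flow) (s : Rstar R).

Let rescaled (t : R) := T (val s * t).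

Fact measurable_rescaled : measurable_fun [set: R * X] (fun z => rescaled z.1 z.2).
Proof.
apply: (measurableT_comp (f := fun z : R * X => T z.1 z.2)
  (g := fun z : R * X => (val s * z.1, z.2))); first exact: measurable_flow.
apply/measurable_fun_pairP; split => /=.
  by apply: (measurableT_comp (mulrl_measurable _)); exact: measurable_fst.
exact: measurable_snd.
Qed.

Fact rescaled0 x : rescaled 0 x = x.
Proof. by rewrite /rescaled mulr0 flow0. Qed.

Fact rescaledD t u x : rescaled (t + u) x = rescaled t (rescaled u x).
Proof. by rewrite /rescaled mulrDr flowD. Qed.

Fact rescaled_preserves t : preserves (rescaled t).
Proof. exact: flow_preserves. Qed.

(* the flow [T o s] *)
Definition rescale : flow :=
  Flow measurable_rescaled rescaled0 rescaledD rescaled_preserves.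

End rescale.

Definition iso_scalings (T : flow) : set (Rstar R) :=
  [set s | flow_isomorphic (rescale T s) T].

Definition iso_times (T : flow) : set (Rstar R) :=
  [set t | isomorphic (T 1) (T (val t))].

Lemma ae_preserves (f : X -> X) (Q : X -> Prop) :
  measurable_fun setT f -> preserves f ->
  (\forall x \ae P, Q x) -> \forall x \ae P, Q (f x).
Proof.
move=> mf pf [A [mA A0 QA]]; exists (f @^-1` A); split.
- by rewrite -[X in measurable X]setTI; exact: mf.
- by rewrite pf.
- by move=> x /= Qfx; exact: QA.
Qed.

Lemma preimage_measurable (f : X -> X) (A : set X) :
  measurable_fun setT f -> measurable A -> measurable (f @^-1` A).
Proof. by move=> mf mA; rewrite -[X in measurable X]setTI; exact: mf. Qed.

Lemma eq_measure_ae (A B : set X) : measurable A -> measurable B ->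
  (\forall x \ae P, A x <-> B x) -> P A = P B.
Proof.
move=> mA mB [N [mN N0 AB]].
rewrite -(measureU0 mA mN N0) -(measureU0 mB mN N0); congr (P _).
apply/seteqP; split => x.
  move=> [Ax|]; last by right.
  have [Nx|NNx] := pselect (N x); first by right.
  by left; apply: contrapT => Bx; apply/NNx/AB => -[/(_ Ax)].
move=> [Bx|]; last by right.
have [Nx|NNx] := pselect (N x); first by right.
by left; apply: contrapT => Ax; apply/NNx/AB => -[_ /(_ Bx)].
Qed.

Fact aut_inv_preserves (S : automorphism) : preserves (aut_inv S).
Proof.
move=> A mA.
have mi := preimage_measurable (measurable_aut_inv S) mA.
rewrite -(aut_preserves S mi); apply: eq_measure_ae => //.
  exact: preimage_measurable (measurable_aut S) mi.
by apply: filterS (aut_funK S) => x /= ->.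
Qed.

Definition aut_sym (S : automorphism) : automorphism :=
  Automorphism (measurable_aut_inv S) (measurable_aut S) (@aut_inv_preserves S)
    (aut_invK S) (aut_funK S).

Section aut_comp.
Variables S1 S2 : automorphism.

Let comp := S1 \o S2.
Let comp_inv := aut_inv S2 \o aut_inv S1.

Fact aut_comp_preserves : preserves comp.
Proof.
move=> A mA; rewrite /comp -[_ @^-1` _]/(S2 @^-1` (S1 @^-1` A)).
rewrite !aut_preserves//; exact: preimage_measurable (measurable_aut S1) mA.
Qed.

Fact aut_comp_funK : \forall x \ae P, comp_inv (comp x) = x.
Proof.
have K := ae_preserves (measurable_aut S2) (@aut_preserves S2) (aut_funK S1).
by apply: filterS2 K (aut_funK S2) => x; rewrite /comp_inv /comp /= => -> ->.
Qed.

Fact aut_comp_invK : \forall x \ae P, comp (comp_inv x) = x.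
Proof.
have K := ae_preserves (measurable_aut_inv S1) (@aut_inv_preserves S1)
  (aut_invK S2).
by apply: filterS2 K (aut_invK S1) => x; rewrite /comp_inv /comp /= => -> ->.
Qed.

Definition aut_comp : automorphism := Automorphism
  (measurableT_comp (measurable_aut S1) (measurable_aut S2))
  (measurableT_comp (measurable_aut_inv S2) (measurable_aut_inv S1))
  aut_comp_preserves aut_comp_funK aut_comp_invK.

End aut_comp.

Fact preserves_id : preserves id.
Proof. by []. Qed.

Fact ae_idK : \forall x \ae P, @id X (id x) = x.
Proof. exact: aeW. Qed.

Definition aut_id : automorphism :=
  Automorphism (@measurable_id _ X setT) (@measurable_id _ X setT)
    preserves_id ae_idK ae_idK.

Lemma conjugates_sym (S : automorphism) (f g : X -> X) :
  measurable_fun setT f -> preserves f ->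
  conjugates S f g -> conjugates (aut_sym S) g f.
Proof.
move=> mf pf H.
have HS := ae_preserves (measurable_aut S) (@aut_preserves S) H.
have Kf := ae_preserves mf pf (aut_funK S).
apply: filterS3 HS (aut_funK S) Kf => x /= HSx Kx Kfx.
by rewrite -HSx Kx Kfx.
Qed.

Lemma conjugates_trans (S1 S2 : automorphism) (f g h : X -> X) :
  conjugates S1 f g -> conjugates S2 g h -> conjugates (aut_comp S2 S1) f h.
Proof.
move=> H1 H2.
have H1' := ae_preserves (measurable_aut_inv S2) (@aut_inv_preserves S2) H1.
by apply: filterS2 H1' H2 => x /= -> ->.
Qed.

Lemma measurable_flow_at (T : flow) t : measurable_fun setT (T t).
Proof. exact: measurable_fun_pair2 (measurable_flow T). Qed.

Lemma flow_isomorphic_sym (T T' : flow) :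
  flow_isomorphic T T' -> flow_isomorphic T' T.
Proof.
move=> [S H]; exists (aut_sym S) => t; apply: conjugates_sym (H t).
  exact: measurable_flow_at.
exact: flow_preserves.
Qed.

Lemma flow_isomorphic_trans (T T' T'' : flow) :
  flow_isomorphic T T' -> flow_isomorphic T' T'' -> flow_isomorphic T T''.
Proof.
move=> [S H] [S' H']; exists (aut_comp S' S) => t.
exact: conjugates_trans (H t) (H' t).
Qed.

Lemma eq_flow_isomorphic (T T' : flow) :
  (forall t x, T t x = T' t x) -> flow_isomorphic T T'.
Proof. by move=> TT'; exists aut_id => t; apply: aeW => x /=; rewrite TT'. Qed.

Lemma flow_isomorphic_rescale (T T' : flow) (s : Rstar R) :
  flow_isomorphic T T' -> flow_isomorphic (rescale T s) (rescale T' s).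
Proof. by move=> [S H]; exists S => t; exact: H. Qed.

Lemma iso_scalings_group (T : flow) :
  group_closed [in iso_scalings T].
Proof.
split=> [|s u].
  rewrite inE; apply: eq_flow_isomorphic => t x.
  by rewrite /= mul1r.
rewrite !inE => sT uT; rewrite /iso_scalings/=.
have uVT : flow_isomorphic (rescale T u^-1%g) T.
  apply: flow_isomorphic_sym.
  apply: flow_isomorphic_trans (flow_isomorphic_rescale u^-1%g uT).
  apply: eq_flow_isomorphic => t x /=.
  by rewrite mulrA divff ?mul1r// Rstar_neq0.
apply: flow_isomorphic_trans uVT.
apply: flow_isomorphic_trans (flow_isomorphic_rescale u^-1%g sT).
by apply: eq_flow_isomorphic => t x /=; rewrite mulrA.
Qed.

End probability_space.

Arguments standard_borel {d} X R.

Section scaling_group.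
Context {d : measure_display} {X : measurableType d} {R : realType}.
Variables (P : probability X R) (T : flow P).

(* [iso_scalings T] as a topological space (with the topology induced from
   [Rstar R]) and as a subgroup of [Rstar R] *)
Definition scaling_group := set_type (iso_scalings T).

HB.instance Definition _ := Topological.on scaling_group.
HB.instance Definition _ :=
  SubChoice.copy scaling_group {s : Rstar R | s \in iso_scalings T}.
HB.instance Definition _ := SubChoice_isSubGroup.Build (Rstar R)
  (fun s => s \in iso_scalings T) scaling_group (iso_scalings_group T).

End scaling_group.

(* Main.v *)
From HB Require Import structures.
Require Import Defs.
From mathcomp Require Import all_boot all_order all_algebra.
From mathcomp Require Import all_classical all_reals all_analysis.
From mathcomp Require Import measurable_realfun.
From mathcomp Require Import lra ring.

(* Give Aut(X, P) a complete metric for the weak topology; a Cauchy sequence has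
   a pointwise limit along a subsequence, for a Polish metric on X.  A measurable
   flow is continuous for this topology.  Hence the pairs (s, S), with S
   conjugating T_t to T_(st) for all t (resp. for t = 1), form a closed subset of
   R^* x Aut(X, P), and I(T) (resp. E(T)) is its projection.  The fibres are
   cosets of a centralizer, so saturations of open sets are open, and a variant
   of the Lusin-Souslin theorem for such projections gives (i).

   For (ii), I(T) is the quotient of the Polish group of these pairs by the
   centralizer C(T), with a translation invariant quotient distance because I(T)
   is abelian.  If y_n is Cauchy in it, one builds automorphisms a_k, b_k such
   that a_k b_k^-1 is a lift of y_(n_k), alternately replacing b by cb with c a
   lift of a small quotient y_n / y_m, and a by c'a.  As only one of the two
   changes at a time, n can be taken large depending on the one to be changed
   next, so that both sequences converge; the limit of y_n is the scaling lifted
   by (lim a_k) (lim b_k)^-1. *)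

Set Implicit Arguments.
Unset Strict Implicit.
Unset Printing Implicit Defensive.

Import Order.TTheory GRing.Theory Num.Theory.
Import numFieldNormedType.Exports.

Local Open Scope classical_set_scope.
Local Open Scope ring_scope.

(** * Pseudo-distances *)

(** The distance [wdist] is invariant under right composition only: left composition by h is
    continuous with a modulus that depends on h, and a [wdist]-Cauchy sequence of automorphisms may
    have a limit that is not invertible. Adding the distance of the inverses gives completeness but
    destroys invariance. The quotient distance on I(T) is built from [wdist], so its Cauchy
    sequences need not lift to Cauchy sequences of the complete distance; this is why completeness
    of the quotient is not formal and two sequences of automorphisms are needed. For the Borel part
    the obstacle is that the projection is not injective. Open saturations make the pieces of a
    suitable partition of its range have locally closed preimages, so that Lusin's separation
    theorem applies to the pieces. No group structure enters there, hence the same argument serves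
    E(T). *)

Section real_sequences.
Context {R : realType}.

Lemma cvg0P (u : R^nat) : (forall n, 0 <= u n) ->
  u @ \oo --> (0 : R) <->
  forall e, 0 < e -> exists N, forall n, (N <= n)%N -> u n < e.
Proof.
move=> u0; split=> [/cvgr0Pnorm_lt ucv e e0|ucv].
  have [N _ H] := ucv e e0; exists N => n Nn.
  by have := H n Nn; rewrite /= ger0_norm.
apply/cvgr0Pnorm_lt => e e0; have [N H] := ucv e e0.
by exists N => // n Nn /=; rewrite ger0_norm// H.
Qed.

Lemma le_cvg0 (u v : R^nat) : (forall n, 0 <= u n <= v n) ->
  v @ \oo --> (0 : R) -> u @ \oo --> (0 : R).
Proof.
by move=> uv v0; apply: squeeze_cvgr (cvg_cst 0) v0; exact: nearW.
Qed.

Lemma cvg0_le0 (c : R) (u : R^nat) : (forall n, c <= u n) ->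
  u @ \oo --> (0 : R) -> c <= 0.
Proof.
move=> cu /cvgr0Pnorm_lt u0; rewrite leNgt; apply/negP => c0.
have [N _ H] := u0 c c0; have := H N (leqnn N) => /=.
by rewrite ltNge (le_trans (cu N))// ler_norm.
Qed.

Lemma cvg0D (u v : R^nat) : u @ \oo --> (0 : R) -> v @ \oo --> (0 : R) ->
  (fun n => u n + v n) @ \oo --> (0 : R).
Proof. by move=> u0 v0; rewrite -[0 in X in _ --> X]addr0; exact: cvgD. Qed.

Lemma cvg0_sub (u : R^nat) (k : nat -> nat) : (forall n, (n <= k n)%N) ->
  u @ \oo --> (0 : R) -> (u \o k) @ \oo --> (0 : R).
Proof.
move=> nk u0; apply/cvgr0Pnorm_lt => e e0.
have /cvgr0Pnorm_lt/(_ e e0)[N _ H] := u0.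
by exists N => // n /= Nn; apply: H; exact: leq_trans Nn (nk n).
Qed.

Lemma exprhalf_gt0 n : 0 < 2^-1 ^+ n :> R.
Proof. by rewrite exprn_gt0. Qed.

Lemma cvg_exprhalf : (fun n => 2^-1 ^+ n : R) @ \oo --> (0 : R).
Proof. by apply: cvg_expr; rewrite ger0_norm// invf_lt1// ltr1n. Qed.

Lemma exprhalf_lt (e : R) : 0 < e -> exists N, 2^-1 ^+ N < e.
Proof.
move=> e0; have := cvg_exprhalf.
move=> /(cvg0P (fun n => ltW (exprhalf_gt0 n)))/(_ e e0)[N H].
by exists N; exact: H.
Qed.

Lemma ler_exprhalf m n : (m <= n)%N -> 2^-1 ^+ n <= 2^-1 ^+ m :> R.
Proof. by move=> mn; rewrite ler_wiXn2l// invf_le1// ler1n. Qed.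

End real_sequences.

Section pseudo_distances.
Context {R : realType}.

(** Distances are bare functions that may vanish off the diagonal: automorphisms that agree almost
    everywhere are at distance 0 without being equal. *)
Record pseudo_dist (Z : Type) (D : Z -> Z -> R) : Prop := PseudoDist {
  pdistxx : forall x, D x x = 0;
  pdistC : forall x y, D x y = D y x;
  pdist_tri : forall y x z, D x z <= D x y + D y z }.

Section sequences.
Context {Z : Type}.
Variable D : Z -> Z -> R.

Definition dcvg (u : nat -> Z) (l : Z) := (fun n => D (u n) l) @ \oo --> (0 : R).

Definition dcauchy (u : nat -> Z) := forall e, 0 < e ->
  exists N, forall m n, (N <= m)%N -> (N <= n)%N -> D (u m) (u n) < e.

Definition dcomplete := forall u, dcauchy u -> exists l, dcvg u l.

Definition ddense (z : nat -> Z) := forall x e, 0 < e -> exists k, D (z k) x < e.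

Definition dopen (U : set Z) := forall x, U x ->
  exists2 e, 0 < e & forall y, D x y < e -> U y.

Definition dclosed (F : set Z) := forall u l, (forall n, F (u n)) ->
  dcvg u l -> F l.

Hypothesis pD : pseudo_dist D.

Lemma pdist_ge0 x y : 0 <= D x y.
Proof.
rewrite -(@pmulrn_lge0 _ _ 2)// -(pdistxx pD x) mulr2n.
by rewrite [X in _ + X](pdistC pD) (pdist_tri pD).
Qed.

Lemma dcvgP u l : dcvg u l <->
  forall e, 0 < e -> exists N, forall n, (N <= n)%N -> D (u n) l < e.
Proof. by apply: cvg0P => n; exact: pdist_ge0. Qed.

Lemma dcauchy_exprhalf (u : nat -> Z) (C : R) :
  (forall n, D (u n) (u n.+1) <= C * 2^-1 ^+ n) -> dcauchy u.
Proof.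
move=> uC.
have C0 : 0 <= C by rewrite -[C]mulr1 -(expr0 2^-1) (le_trans (pdist_ge0 _ _) (uC 0%N)).
(* The subtracted tail of the geometric series is what lets the induction on [k] close. *)
have H m k : D (u m) (u (m + k)%N) <= C * 2^-1 ^+ m *+ 2 - C * 2^-1 ^+ (m + k)%N *+ 2.
  elim: k => [|k IH]; first by rewrite addn0 (pdistxx pD) subrr.
  rewrite (le_trans (pdist_tri pD (u (m + k)%N) _ _))// addnS.
  rewrite (le_trans (lerD IH (uC _)))// exprS; lra.
have H2 m k : D (u m) (u (m + k)%N) <= C * 2^-1 ^+ m *+ 2.
  by rewrite (le_trans (H _ _))// gerBl mulrn_wge0// mulr_ge0// ltW// exprhalf_gt0.
move=> e e0.
have [N HN] : exists N, (C * 4) * 2^-1 ^+ N < e.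
  (* The denominator is [C * 4 + 1] to allow [C = 0]; the 4 covers two tails of size
     [2 * C * 2^-1 ^+ N]. *)
  have [N HN] := exprhalf_lt (divr_gt0 e0 (ltr_wpDl (mulr_ge0 C0 (ler0n _ 4)) ltr01)).
  exists N; rewrite ltr_pdivlMr in HN; last by rewrite ltr_wpDl// mulr_ge0.
  by rewrite (le_lt_trans _ HN)// mulrC ler_wpM2l// ?lerDl// ltW// exprhalf_gt0.
exists N => m n Nm Nn; rewrite (le_lt_trans (pdist_tri pD (u N) _ _))//.
rewrite (pdistC pD); have := H2 N (m - N)%N; have := H2 N (n - N)%N.
rewrite !subnKC//; lra.
Qed.

Lemma dcauchy_sub_dcvg u l (k : nat -> nat) : (forall n, (n <= k n)%N) ->
  dcauchy u -> dcvg (u \o k) l -> dcvg u l.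
Proof.
move=> nk uc /dcvgP ul; apply/dcvgP => e e0.
have [N H] := uc (e / 2) (divr_gt0 e0 (ltr0Sn _ 1)).
have [M H'] := ul (e / 2) (divr_gt0 e0 (ltr0Sn _ 1)).
exists N => n Nn; set p := maxn N M.
rewrite (le_lt_trans (pdist_tri pD (u (k p)) _ _))//.
rewrite [ltRHS]splitr ltrD//.
  by rewrite H// (leq_trans _ (nk p))// leq_maxl.
by rewrite (H' p)// leq_maxr.
Qed.

Lemma dclosedC U : dopen U -> dclosed (~` U).
Proof.
move=> oU u l uU /dcvgP ul Ul; have [e e0 H] := oU _ Ul.
by have [N HN] := ul e e0; apply: (uU N); apply: H; rewrite (pdistC pD) HN.
Qed.

Lemma dclosedI A B : dclosed A -> dclosed B -> dclosed (A `&` B).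
Proof.
move=> cA cB u l uAB ul.
by split; [apply: cA ul|apply: cB ul] => n; have [] := uAB n.
Qed.

Lemma dclosed_ball x r : dclosed [set y | D x y <= r].
Proof.
move=> u l ux ul /=; rewrite -subr_le0; apply: (cvg0_le0 _ ul) => n.
by rewrite lerBlDl (le_trans (pdist_tri pD (u n) _ _))// lerD2r; exact: ux.
Qed.

Lemma dopenI A B : dopen A -> dopen B -> dopen (A `&` B).
Proof.
move=> oA oB x [/oA[e e0 He] /oB[f f0 Hf]].
exists (Num.min e f); first by rewrite lt_min e0.
by move=> y; rewrite lt_min => /andP[? ?]; split; [exact: He|exact: Hf].
Qed.

Lemma dopen_ball x r : dopen [set y | D x y < r].
Proof.
move=> y /= xy; exists (r - D x y); first by rewrite subr_gt0.
by move=> z yz; rewrite (le_lt_trans (pdist_tri pD y _ _))// -ltrBrDl.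
Qed.

(** For open [U] these are closed sets increasing to [U]; they serve wherever an open set has to be
    approximated by closed ones. *)
Definition shrinking (U : set Z) (n : nat) :=
  [set x | forall y, D x y < 2^-1 ^+ n -> U y].

Lemma dclosed_shrinking U n : dclosed (shrinking U n).
Proof.
move=> u l uF /dcvgP ul y ly.
have [N H] := ul (2^-1 ^+ n - D l y) ltac:(by rewrite subr_gt0).
apply: (uF N); rewrite (le_lt_trans (pdist_tri pD l _ _))//.
by rewrite -ltrBrDr H.
Qed.

Lemma dopen_shrinkingC U n : dopen (~` shrinking U n).
Proof.
move=> x /existsNP[y /not_implyP[xy Uy]].
exists (2^-1 ^+ n - D x y); first by rewrite subr_gt0.
move=> x' xx' /(_ y) H; apply/Uy/H.
by rewrite (le_lt_trans (pdist_tri pD x _ _))// (pdistC pD x') -ltrBrDr.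
Qed.

Lemma shrinking_homo U : {homo shrinking U : m n / (m <= n)%N >-> m `<=` n}.
Proof.
move=> m n mn x H y xy; apply: H.
by rewrite (lt_le_trans xy)// ler_exprhalf.
Qed.

Lemma near_shrinking U x : dopen U -> U x ->
  exists n, forall y, D x y < 2^-1 ^+ n -> shrinking U n y.
Proof.
move=> oU /oU[e e0 H]; have [n He] := exprhalf_lt (divr_gt0 e0 (ltr0Sn _ 1)).
exists n => y xy w yw; apply: H; rewrite (le_lt_trans (pdist_tri pD y _ _))//.
by rewrite [e]splitr ltrD// (lt_trans _ He).
Qed.

Lemma bigcup_shrinking U : dopen U -> \bigcup_n shrinking U n = U.
Proof.
move=> oU; apply/seteqP; split => [x [n _]|x Ux].
  by apply; rewrite (pdistxx pD) exprhalf_gt0.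
have [n H] := near_shrinking oU Ux.
by exists n => //; apply: H; rewrite (pdistxx pD) exprhalf_gt0.
Qed.

Lemma fast_dcauchy u : dcauchy u -> exists k : nat -> nat,
  (forall n, (n <= k n)%N) /\
  forall n, D (u (k n)) (u (k n.+1)) < (2^-1 ^+ n) ^+ 2.
Proof.
move=> uc; have [N HN] := choice (fun n => uc _ (exprn_gt0 2 (exprhalf_gt0 n))).
(* Summing the [N i] for [i <= n] puts both [k n] and [k n.+1] above [N n]; the added [n] gives
   [n <= k n]. *)
pose k n := (\sum_(i < n.+1) N i + n)%N.
exists k; split=> [n|n]; first exact: leq_addl.
apply: HN; rewrite /k; first by rewrite big_ord_recr/= -addnA addnCA leq_addr.
by rewrite !big_ord_recr/= -!addnA addnCA leq_addr.
Qed.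

End sequences.

End pseudo_distances.

(** * Borel images *)

Section borel_images.
Context {R : realType} {Z : Type}.
Variables (D : Z -> Z -> R) (z : nat -> Z) (f : Z -> R).
Hypotheses (pD : pseudo_dist D) (cD : dcomplete D) (dz : ddense D z).
Hypothesis fcont : forall x e, 0 < e ->
  exists2 d, 0 < d & forall y, D x y < d -> `|f x - f y| < e.

Definition separated (A B : set R) :=
  exists C : set R, [/\ measurable C, A `<=` C & B `<=` ~` C].

Lemma separated_bigcup (A B : nat -> set R) :
  (forall i j, separated (A i) (B j)) ->
  separated (\bigcup_i A i) (\bigcup_j B j).
Proof.
move=> sAB.
have [C HC] := @choice (nat * nat) (set R)
  (fun ij C => [/\ measurable C, A ij.1 `<=` C & B ij.2 `<=` ~` C])
  (fun ij => sAB ij.1 ij.2).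
exists (\bigcup_i \bigcap_j C (i, j)); split.
- by apply: bigcupT_measurable => i; apply: bigcapT_measurable => j;
    have [] := HC (i, j).
- move=> x [i _ Aix]; exists i => // j _.
  by have [_ sC _] := HC (i, j); exact: sC.
- move=> x [j _ Bjx] [i _ /(_ j I)].
  by have [_ _ sC] := HC (i, j); exact: sC.
Qed.

(* Lusin's separation theorem: if the images were not separated, then so would be
   those of smaller and smaller pieces of [A] and [B], which shrink to points
   with distinct images. *)
Lemma separated_dclosed (A B : set Z) : dclosed D A -> dclosed D B ->
  f @` A `&` f @` B = set0 -> separated (f @` A) (f @` B).
Proof.
move=> cA cB AB0; apply: contrapT => nAB.
pose ball i n := [set x | D (z i) x <= 2^-1 ^+ n].
pose nsep (p : set Z * set Z) := ~ separated (f @` p.1) (f @` p.2).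
have step n (p : set Z * set Z) : exists ij : nat * nat, nsep p ->
    nsep (p.1 `&` ball ij.1 n, p.2 `&` ball ij.2 n).
  apply: contrapT => /forallNP H.
  have [np nall] : nsep p /\ forall i j,
      separated (f @` (p.1 `&` ball i n)) (f @` (p.2 `&` ball j n)).
    split; first by apply: contrapT => np; apply: (H (0%N, 0%N)).
    by move=> i j; apply: contrapT => K; apply: (H (i, j)).
  apply: np; have := separated_bigcup nall.
  have cover (E : set Z) : \bigcup_i (f @` (E `&` ball i n)) = f @` E.
    apply/seteqP; split=> [_ [i _ [x [Ex _] <-]]|_ [x Ex <-]]; first by exists x.
    have [i xi] := dz x (exprhalf_gt0 n).
    by exists i => //; exists x => //; split=> //; exact: ltW.
  by rewrite !cover.
have [g Hg] := @choice _ _ (fun (q : nat * (set Z * set Z)) ij => nsep q.2 ->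
    nsep (q.2.1 `&` ball ij.1 q.1, q.2.2 `&` ball ij.2 q.1))
    (fun q => step q.1 q.2).
pose fix st n : set Z * set Z := if n is m.+1 then
  ((st m).1 `&` ball (g (m, st m)).1 m, (st m).2 `&` ball (g (m, st m)).2 m)
  else (A, B).
have nst n : nsep (st n) by elim: n => [//|n IH]; exact: (Hg (n, st n)).
have sub1 m k : (st (m + k)%N).1 `<=` (st m).1.
  by elim: k => [|k IH]; [rewrite addn0|rewrite addnS => x [/IH]].
have sub2 m k : (st (m + k)%N).2 `<=` (st m).2.
  by elim: k => [|k IH]; [rewrite addn0|rewrite addnS => x [/IH]].
have cl n : dclosed D (st n).1 /\ dclosed D (st n).2.
  by elim: n => [//|n [IH1 IH2]]; split; apply: dclosedI => //; exact: dclosed_ball.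
(* An empty set is separated from every set, so both pieces of a pair that is not separated are
   inhabited. *)
have ne n : (exists a, (st n).1 a) /\ (exists b, (st n).2 b).
  split; apply: contrapT => /forallNP e; apply: (nst n).
    by exists set0; split; [exact: measurable0|move=> y [x /e]|move=> y _ []].
  by exists setT; split; [exact: measurableT| |move=> y [x /e]].
have [a Ha] := choice (fun n => (ne n).1).
have [b Hb] := choice (fun n => (ne n).2).
have small n x y i : ball i n x -> ball i n y -> D x y <= 2 * 2^-1 ^+ n.
  move=> xi yi; rewrite (le_trans (pdist_tri pD (z i) _ _))// (pdistC pD).
  by rewrite mulrDl mul1r lerD.
(* Cantor's intersection theorem. Only [F n.+1] is confined to a ball of radius [2^-1 ^+ n], since
   the pieces at stage 0 are [A] and [B] themselves. *)
have shrink (u : nat -> Z) (F : nat -> set Z) : (forall n, F n (u n)) ->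
    (forall n, dclosed D (F n)) -> (forall m k, F (m + k)%N `<=` F m) ->
    (forall n, exists i, F n.+1 `<=` ball i n) -> exists l, forall n, F n l.
  move=> Fu Fc Fs Fb; have [l ul] : exists l, dcvg D (u \o S) l.
    apply: cD; apply: (dcauchy_exprhalf pD) => n; have [i Fi] := Fb n.
    apply: (@small _ _ _ i); apply: Fi; first exact: Fu.
    by apply: (Fs n.+1 1%N); rewrite addn1; exact: Fu.
  exists l => n; apply: (Fc n (fun k => u (n + k).+1)).
    by move=> k; apply: (Fs n k.+1); rewrite addnS; exact: Fu.
  have := @cvg0_sub _ _ (fun k => (n + k)%N) _ ul; apply => k.
  exact: leq_addl.
have [la Hla] := shrink a (fun n => (st n).1) Ha (fun n => (cl n).1) sub1
  (fun n => ex_intro _ (g (n, st n)).1 (@subIsetr _ _ _)).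
have [lb Hlb] := shrink b (fun n => (st n).2) Hb (fun n => (cl n).2) sub2
  (fun n => ex_intro _ (g (n, st n)).2 (@subIsetr _ _ _)).
have fab : f la != f lb.
  apply/eqP => fab; have : (f @` A `&` f @` B) (f la).
    by split; [exists la => //; exact: (Hla 0%N)|exists lb => //; exact: (Hlb 0%N)].
  by rewrite AB0.
pose e := `|f la - f lb| / 2; have e0 : 0 < e by rewrite divr_gt0// normr_gt0 subr_eq0.
have [da da0 Hda] := fcont la e0; have [db db0 Hdb] := fcont lb e0.
have [N HN] : exists N, 2^-1 ^+ N < Num.min da db / 2.
  by apply: exprhalf_lt; rewrite divr_gt0// lt_min da0.
have HN2 : 2 * 2^-1 ^+ N < Num.min da db by rewrite mulrC -ltr_pdivlMr.
(* At stage [N.+1] the image of the first piece is inside the ball of radius [e] about [f la]. That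
   of the second is within [e] of [f lb], hence outside this ball: the pieces are separated after
   all. *)
apply: (nst N.+1); exists [set r | `|f la - r| < e]; split.
- rewrite (_ : [set r | _] = ball_ Num.norm (f la) e)//.
  by apply: open_measurable; exact: ball_open.
- move=> _ [x Fx <-] /=; apply: Hda.
  rewrite (@le_lt_trans _ _ (2 * 2^-1 ^+ N))//; last first.
    by rewrite (lt_le_trans HN2)// ge_min lexx.
  by apply: (@small _ _ _ (g (N, st N)).1); [apply: (Hla N.+1).2|apply: Fx.2].
- move=> _ [x Fx <-] /=; apply/negP; rewrite -leNgt.
  have : `|f lb - f x| < e.
    apply: Hdb; rewrite (@le_lt_trans _ _ (2 * 2^-1 ^+ N))//; last first.
      by rewrite (lt_le_trans HN2)// ge_min lexx orbT.
    by apply: (@small _ _ _ (g (N, st N)).2); [apply: (Hlb N.+1).2|apply: Fx.2].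
  have := ler_distD (f x) (f la) (f lb).
  rewrite [`|f x - f lb|]distrC /e; lra.
Qed.

(** An open set is a countable union of closed [shrinking] sets, which brings the claim back to
    pairs of closed sets. *)
Lemma separated_locally_closed (A B U V F G : set Z) :
  A = U `&` F -> B = V `&` G ->
  dopen D U -> dclosed D F -> dopen D V -> dclosed D G ->
  f @` A `&` f @` B = set0 -> separated (f @` A) (f @` B).
Proof.
move=> -> -> /(bigcup_shrinking pD) UE cF /(bigcup_shrinking pD) VE cG.
rewrite -UE -VE => dis; have cU := @dclosed_shrinking _ _ _ pD U.
have cV := @dclosed_shrinking _ _ _ pD V.
rewrite !setI_bigcupl !image_bigcup; apply: separated_bigcup => i j.
apply: separated_dclosed; [exact: dclosedI|exact: dclosedI|].
apply/seteqP; split=> // y [[x [Ux Fx] xy] [x' [Vx' Gx'] x'y]].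
rewrite -dis; split; [exists x => //|exists x' => //].
  by split=> //; exists i.
by split=> //; exists j.
Qed.

Hypothesis fopen : forall V, dopen D V -> dopen D (f @^-1` (f @` V)).

(* The sets [cell s] of a given length partition the range of [f]: each [y] is
   put in the cell coding its leftmost branch in the tree of the [branch s]. *)
Fixpoint branch (s : seq nat) : set Z :=
  if s is k :: s' then branch s' `&` [set x | D (z k) x < 2^-1 ^+ size s']
  else setT.

Fixpoint cell (s : seq nat) : set R :=
  if s is k :: s' then
    [set y | [/\ cell s' y, (f @` branch s) y &
      forall j, (j < k)%N -> ~ (f @` branch (j :: s')) y]]
  else range f.

Lemma dopen_branch s : dopen D (branch s).
Proof.
elim: s => [|k s IH] /=; first by move=> x _; exists 1.
by apply: dopenI => //; exact: dopen_ball.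
Qed.

Lemma cell_branch s : cell s `<=` f @` branch s.
Proof. by case: s => [//|k s] y []. Qed.

Lemma sub_branch s t : branch (s ++ t) `<=` branch t.
Proof. by elim: s => [//|k s IH] x [/IH]. Qed.

Lemma sub_cell s t : cell (s ++ t) `<=` cell t.
Proof. by elim: s => [//|k s IH] x [/IH]. Qed.

Lemma cell_inj s t y : size s = size t -> cell s y -> cell t y -> s = t.
Proof.
elim: s t => [|k s IH] [|l t]//= [st] [Es fs ns] [Et ft nt].
have ste := IH _ st Es Et; subst t; congr (_ :: _).
by have [kl|lk|//] := ltngtP k l; [have := nt _ kl|have := ns _ lk].
Qed.

Lemma cell_cover n : range f `<=` \bigcup_(s in [set s | size s = n]) cell s.
Proof.
elim: n => [|n IH] y yf; first by exists [::].
have [s sn Es] := IH y yf.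
have [k0 Hk0] : exists k, `[< (f @` branch (k :: s)) y >].
  have [x bx xy] := cell_branch Es.
  have [k Hk] := dz x (exprhalf_gt0 (size s)).
  by exists k; apply/asboolP; exists x.
have exk : exists k, `[< (f @` branch (k :: s)) y >] by exists k0.
case: (ex_minnP exk) => k /asboolP ky kmin.
exists (k :: s); first by rewrite /= sn.
split=> // j jk jy; have /kmin : `[< (f @` branch (j :: s)) y >] by apply/asboolP.
by rewrite leqNgt jk.
Qed.

(** Here [fopen] is used: meeting the image of a branch is an open condition on [x], so that missing
    the images of the earlier branches is a closed one. *)
Lemma cell_locally_closed s : exists U F : set Z,
  [/\ dopen D U, dclosed D F & f @^-1` (cell s) = U `&` F].
Proof.
elim: s => [|k s [U [F [oU cF UF]]]].
  exists setT, setT; split=> //; first by move=> x _; exists 1.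
  by apply/seteqP; split=> // x _ /=; exists x.
exists (U `&` f @^-1` (f @` branch (k :: s))),
  (F `&` [set x | forall j, (j < k)%N -> ~ (f @` branch (j :: s)) (f x)]).
split.
- by apply: dopenI => //; apply/fopen/dopen_branch.
- apply: dclosedI => // u l ul cul j jk.
  have := dclosedC pD (fopen (@dopen_branch (j :: s))) _ cul.
  by apply => n; exact: ul.
- apply/seteqP; split=> x /=.
    move=> [Esx fx nx]; have : (f @^-1` cell s) x by [].
    by rewrite UF => -[Ux Fx].
  move=> [[Ux ux] [Fx nx]]; split=> //.
  by suff: (f @^-1` cell s) x by []; rewrite UF.
Qed.

Lemma separated_cell s t : cell s `&` cell t = set0 -> separated (cell s) (cell t).
Proof.
move=> st; have imp r : f @` (f @^-1` (cell r)) = cell r.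
  apply/seteqP; split=> [_ [x ? <-]//|y ry].
  by have [x _ xy] := cell_branch ry; exists x => //=; rewrite xy.
have [U [F [oU cF UF]]] := cell_locally_closed s.
have [V [G [oV cG VG]]] := cell_locally_closed t.
rewrite -(imp s) -(imp t) in st *.
exact: separated_locally_closed UF VG oU cF oV cG st.
Qed.

(** Each cell is enclosed in a Borel set [B s] so tightly that a real lying in some [B s] at every
    level follows a single branch; by completeness the branch shrinks to a point, which [f] sends to
    that real. *)
Theorem measurable_range : measurable (range f).
Proof.
have sep (p : seq nat * seq nat) : exists C : set R, measurable C /\
    (cell p.1 `&` cell p.2 = set0 -> cell p.1 `<=` C /\ cell p.2 `<=` ~` C).
  have [e|ne] := pselect (cell p.1 `&` cell p.2 = set0).
    by have [C [mC sC tC]] := separated_cell e; exists C.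
  by exists set0; split.
have [C HC] := choice sep.
(* For disjoint cells, [C (s, t)] contains [cell s] and misses [cell t]; removing [C (t, s)] as well
   makes [B s] and [B t] disjoint. The closure provides points of the branch with values near a
   given point of [B s]. *)
pose B s := closure (f @` branch s) `&`
  \bigcap_t (if pselect (cell s `&` cell t = set0) then C (s, t) `\` C (t, s) else setT).
have mB s : measurable (B s).
  apply: measurableI; first by apply: closed_measurable; exact: closed_closure.
  rewrite -[X in measurable X]setCK setC_bigcap; apply: measurableC.
  apply: countable_bigcupT_measurable => // t; apply: measurableC.
  case: pselect => [st|?]; last exact: measurableT.
  by apply: measurableD; exact: (HC _).1.
suff -> : range f = \bigcap_n \bigcup_s (if size s == n then B s else set0).
  apply: bigcapT_measurable => n; apply: countable_bigcupT_measurable => // s.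
  by case: ifP.
apply/seteqP; split=> y.
  move=> yf n _; have [s /= sn Es] := cell_cover n yf.
  exists s => //; rewrite sn eqxx; split.
    by apply: subset_closure; exact: cell_branch.
  move=> t _; case: pselect => [st|//]; split.
    by have [/= H _] := (HC (s, t)).2 st; exact: H.
  rewrite setIC in st.
  by have [/= _ H] := (HC (t, s)).2 st; exact: H.
move=> H.
have [s Hs] : {s : nat -> seq nat & forall n, size (s n) = n /\ B (s n) y}.
  apply: (@choice _ _ (fun n t => size t = n /\ B t y)) => n; have [t _] := H n I.
  by case: eqP => [tn Bt|_ []]; exists t.
(* As [y] lies in both [B (s m)] and [B (s n)], the two cells cannot be disjoint. *)
have meet m n : exists w, cell (s m) w /\ cell (s n) w.
  apply: contrapT => /forallNP nw.
  have st : cell (s m) `&` cell (s n) = set0.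
    by apply/seteqP; split=> // w [? ?]; apply: (nw w).
  have [_ [_ /(_ (s n) I)]] := Hs m; case: pselect => [? [yC _]|//].
  have [_ [_ /(_ (s m) I)]] := Hs n; rewrite setIC in st.
  by case: pselect => [? []|].
(* New letters are added at the head, so the ancestor of [s n] of length [m] is a tail of it. Its
   cell shares a point with [cell (s m)], and distinct sequences of equal length have disjoint
   cells. *)
have nest m n : (m <= n)%N -> branch (s n) `<=` branch (s m).
  move=> mn; have [w [wm wn]] := meet m n.
  rewrite -(cat_take_drop (n - m) (s n)) in wn *.
  have <- : drop (n - m) (s n) = s m; last exact: sub_branch.
  apply: cell_inj (sub_cell wn) wm.
  by rewrite size_drop !(Hs _).1 subKn.
have [x Hx] : {x : nat -> Z & forall n, branch (s n) (x n) /\ `|y - f (x n)| < 2^-1 ^+ n}.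
  apply: (@choice _ _ (fun n x => branch (s n) x /\ `|y - f x| < 2^-1 ^+ n)) => n.
  have [_ [cy _]] := Hs n.
  have [_ [[x bx <-] xy]] := cy _ (nbhsx_ballx y _ (exprhalf_gt0 n)).
  by exists x.
have small n a b : branch (s n.+1) a -> branch (s n.+1) b -> D a b <= 2 * 2^-1 ^+ n.
  have := (Hs n.+1).1; case: (s n.+1) => [//|k t [tn]] [_ /= ka] [_ kb].
  rewrite (le_trans (pdist_tri pD (z k) _ _))// (pdistC pD).
  by rewrite mulrDl mul1r -tn lerD// ltW.
have [l xl] : exists l, dcvg D (x \o S) l.
  apply: cD; apply: (dcauchy_exprhalf pD) => n.
  by apply: small; [exact: (Hx _).1|apply: (nest n.+1 n.+2) => //; exact: (Hx _).1].
exists l => //; apply/eqP; rewrite -subr_eq0 -normr_le0.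
apply/ler_addgt0Pr => e e0; rewrite add0r.
have [d d0 Hd] := fcont l (divr_gt0 e0 (ltr0Sn _ 1)).
have [N1 HN1] := (dcvgP pD _ _).1 xl d d0.
have [N2 HN2] := exprhalf_lt (divr_gt0 e0 (ltr0Sn R 1)).
pose N := maxn N1 N2.
have h1 : `|f l - f (x N.+1)| < e / 2.
  by apply: Hd; rewrite (pdistC pD); apply: HN1; rewrite leq_maxl.
have h2 : `|y - f (x N.+1)| < e / 2.
  rewrite (lt_trans (Hx _).2)// (le_lt_trans _ HN2)// ler_exprhalf//.
  by rewrite (leq_trans (leq_maxr N1 N2))// leqnSn.
have := ler_distD (f (x N.+1)) (f l) y.
rewrite [`|f (x N.+1) - y|]distrC; lra.
Qed.

End borel_images.

(** * The measure algebra and the weak topology *)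

Section measure_algebra.
Context {d : measure_display} {X : measurableType d} {R : realType}.
Variable P : probability X R.
Implicit Types A B C : set X.

Definition pr A : R := fine (P A).

Definition sd A B : R := pr (A `+` B).

Lemma prE A : measurable A -> P A = (pr A)%:E.
Proof. by move=> mA; rewrite fineK// fin_num_measure. Qed.

Lemma pr_ge0 A : 0 <= pr A.
Proof. by rewrite fine_ge0. Qed.

Lemma pr_le A B : measurable A -> measurable B -> A `<=` B -> pr A <= pr B.
Proof. by move=> mA mB AB; rewrite -lee_fin -!prE// le_measure// inE. Qed.

Lemma pr_setU_le A B : measurable A -> measurable B -> pr (A `|` B) <= pr A + pr B.
Proof.
move=> mA mB; rewrite -lee_fin EFinD -!prE//; last exact: measurableU.
by rewrite measureU2.
Qed.

Lemma pr_setC A : measurable A -> pr (~` A) = 1 - pr A.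
Proof. by move=> mA; rewrite /pr probability_setC// prE. Qed.

Lemma pr_le1 A : measurable A -> pr A <= 1.
Proof. by move=> mA; rewrite -subr_ge0 -pr_setC// pr_ge0. Qed.

Lemma pr_setD A B : measurable A -> measurable B -> B `<=` A ->
  pr (A `\` B) = pr A - pr B.
Proof.
move=> mA mB BA; apply/EFin_inj; rewrite EFinB -!prE//; last exact: measurableD.
by rewrite measureD// ?(setIidr BA)//= ltey_eq fin_num_measure.
Qed.

Lemma measurable_setY A B : measurable A -> measurable B -> measurable (A `+` B).
Proof. by move=> mA mB; rewrite setY_def; apply: measurableU; exact: measurableD. Qed.

Hint Resolve measurable_setY : core.

Lemma in_setY A B x : (A `+` B) x <-> ~ (A x <-> B x).
Proof.
rewrite setY_def; split=> [[] [h1 h2] [h3 h4]|nAB]; [exact/h2/h3|exact/h2/h4|].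
have [Ax|nAx] := pselect (A x).
  by left; split=> // Bx; apply: nAB.
right; split=> //; apply: contrapT => nBx; apply: nAB.
by split=> [/nAx|/nBx].
Qed.

Lemma not_in_setY A B x : ~ (A `+` B) x <-> (A x <-> B x).
Proof.
split=> [|AB /in_setY//].
by move=> H; apply: contrapT => nAB; apply/H/in_setY.
Qed.

Lemma sd_ge0 A B : 0 <= sd A B. Proof. exact: pr_ge0. Qed.

Lemma sdxx A : sd A A = 0.
Proof. by rewrite /sd setYK /pr measure0. Qed.

Lemma sd_sym A B : sd A B = sd B A. Proof. by rewrite /sd setYC. Qed.

Lemma sd_tri B A C : measurable A -> measurable B -> measurable C ->
  sd A C <= sd A B + sd B C.
Proof.
move=> mA mB mC; apply: le_trans (pr_setU_le _ _); auto.
apply: pr_le; [by auto|by apply: measurableU; auto|].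
move=> x /in_setY AC; apply: contrapT => /not_orP[].
by move=> /not_in_setY AB /not_in_setY BC; apply: AC; rewrite AB.
Qed.

Lemma sd_setC A B : sd (~` A) (~` B) = sd A B.
Proof.
congr pr; apply/seteqP; split=> x /in_setY nAB; apply/in_setY => AB; apply: nAB.
  by split=> h /AB.
by split=> h; apply: contrapT => /AB.
Qed.

Lemma sd_setU A B A' B' : measurable A -> measurable B -> measurable A' ->
  measurable B' -> sd (A `|` B) (A' `|` B') <= sd A A' + sd B B'.
Proof.
move=> mA mB mA' mB'; apply: le_trans (pr_setU_le _ _); auto.
apply: pr_le; [by apply: measurable_setY; exact: measurableU|by apply: measurableU; auto|].
move=> x /in_setY AC; apply: contrapT => /not_orP[].
by move=> /not_in_setY AB /not_in_setY BC; apply: AC; split=> -[] /=; tauto.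
Qed.

Lemma sd_subset A B : measurable A -> measurable B -> A `<=` B ->
  sd A B = pr B - pr A.
Proof.
by move=> mA mB AB; rewrite -pr_setD// /sd setY_def (_ : A `\` B = set0) ?set0U// setD_eq0.
Qed.

Lemma sd_prD A B : measurable A -> measurable B -> sd A B = pr (A `\` B) + pr (B `\` A).
Proof.
move=> mA mB; apply/EFin_inj; rewrite EFinD -!prE//.
- rewrite setY_def measureU//; [exact: measurableD|exact: measurableD|].
  by apply/seteqP; split=> // x [[? ?] [? ?]].
- exact: measurableD.
- exact: measurableD.
- by auto.
Qed.

Lemma pr_setDE A B : measurable A -> measurable B -> pr (A `\` B) = pr A - pr (A `&` B).
Proof.
move=> mA mB; rewrite -pr_setD//; last exact: measurableI.
by rewrite setDIr setDv set0U.
Qed.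

Lemma ler_pr_sd A B : measurable A -> measurable B -> `|pr A - pr B| <= sd A B.
Proof.
move=> mA mB; rewrite sd_prD// !pr_setDE// [B `&` A]setIC.
have mAB := measurableI _ _ mA mB.
have h1 : pr (A `&` B) <= pr A by apply: pr_le => //; exact: subIsetl.
have h2 : pr (A `&` B) <= pr B by apply: pr_le => //; exact: subIsetr.
 rewrite ler_norml; apply/andP; split; lra.
Qed.

Lemma sd_preimage f A B : measurable_fun setT f -> preserves P f ->
  measurable A -> measurable B -> sd (f @^-1` A) (f @^-1` B) = sd A B.
Proof.
move=> mf pf mA mB; rewrite /sd /pr -(pf (A `+` B))//; auto.
Qed.

Lemma sd_ae A B : measurable A -> measurable B ->
  (\forall x \ae P, A x <-> B x) <-> sd A B = 0.
Proof.
move=> mA mB; split.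
  move=> [N [mN N0 HN]]; apply/eqP; rewrite eq_le sd_ge0 andbT.
  have -> : 0 = pr N by rewrite /pr N0.
  apply: pr_le; auto => x /in_setY AB; exact: HN.
move=> AB0; exists (A `+` B); split; auto.
  by rewrite prE; [rewrite [pr _]AB0|auto].
by move=> x /= ?; apply/in_setY.
Qed.

Lemma sd_cvg_bigcup (F : nat -> set X) : (forall n, measurable (F n)) ->
  {homo F : m n / (m <= n)%N >-> m `<=` n} ->
  (fun n => sd (\bigcup_k F k) (F n)) @ \oo --> (0 : R).
Proof.
move=> mF ndF; have mU : measurable (\bigcup_k F k) by exact: bigcupT_measurable.
have : P \o F @ \oo --> P (\bigcup_n F n).
  by apply: nondecreasing_cvg_mu => // m n mn; apply/subsetPset; exact: ndF.
rewrite [P (\bigcup_n _)]prE// => /fine_cvg; rewrite -[fine \o _]/(pr \o F) => cF.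
rewrite (_ : (fun n => _) = (fun n => pr (\bigcup_k F k) - (pr \o F) n)).
  by rewrite -[0 in X in _ --> X](subrr (pr (\bigcup_k F k))); apply: cvgB => //; exact: cvg_cst.
by apply/funext => n; rewrite sd_sym sd_subset//; exact: bigcup_sup.
Qed.

Lemma sd_small_bigcup (F : nat -> set X) : (forall n, measurable (F n)) ->
  forall e, 0 < e -> exists n, sd (\bigcup_k F k) (\big[setU/set0]_(k < n) F k) < e.
Proof.
move=> mF e e0; pose G n := \big[setU/set0]_(k < n) F k.
have mG n : measurable (G n) by exact: bigsetU_measurable.
have GF : \bigcup_k F k = \bigcup_k G k.
  apply/seteqP; split=> [x [k _ Fx]|x [k _]]; last exact: bigsetU_bigcup.
  by exists k.+1 => //; rewrite /G big_ord_recr/=; right.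
have ndG : {homo G : m n / (m <= n)%N >-> m `<=` n}.
  by exact: subset_bigsetU.
have /cvg0P H := sd_cvg_bigcup mG ndG.
have [N HN] := H (fun n => sd_ge0 _ _) e e0.
by exists N; rewrite GF; exact: HN.
Qed.

(** Closure under complement is asked of [U] only up to a small error, since the intended [U],
    finite unions of balls, is not closed under complements. *)
Lemma approximable_sigma_algebra (U : set (set X)) : U `<=` measurable ->
  U set0 -> (forall A B, U A -> U B -> U (A `|` B)) ->
  (forall A, U A -> forall e, 0 < e -> exists2 B, U B & sd (~` A) B < e) ->
  sigma_algebra setT
    [set A | measurable A /\ forall e, 0 < e -> exists2 B, U B & sd A B < e].
Proof.
move=> mU U0 UU UC; split.
- by split=> // e e0; exists set0 => //; rewrite sdxx.
- move=> A [mA HA]; rewrite setTD; split=> [|e e0]; first exact: measurableC.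
  have [B UB AB] := HA (e / 2) (divr_gt0 e0 (ltr0Sn _ 1)).
  have [C UC' BC] := UC B UB (e / 2) (divr_gt0 e0 (ltr0Sn _ 1)).
  exists C => //; have mB := mU _ UB.
  rewrite (@le_lt_trans _ _ (sd (~` A) (~` B) + sd (~` B) C))//.
    by apply: sd_tri; [exact: measurableC|exact: measurableC|exact: mU].
  by rewrite sd_setC [ltRHS]splitr ltrD.
- move=> F HF; have mF n : measurable (F n) by have [] := HF n.
  split=> [|e e0]; first exact: bigcupT_measurable.
  have [n Hn] := sd_small_bigcup mF (divr_gt0 e0 (ltr0Sn _ 1)).
  have mFn m : measurable (\big[setU/set0]_(k < m) F k) by exact: bigsetU_measurable.
  have [B UB FB] : exists2 B, U B & sd (\big[setU/set0]_(k < n) F k) B < e / 2.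
    elim: (n) (e / 2) (divr_gt0 e0 (ltr0Sn _ 1)) => [|m IH] c c0.
      by exists set0 => //; rewrite big_ord0 sdxx.
    have [B UB FB] := IH (c / 2) (divr_gt0 c0 (ltr0Sn _ 1)).
    have [C UC' FC] := (HF m).2 (c / 2) (divr_gt0 c0 (ltr0Sn _ 1)).
    exists (B `|` C); first exact: UU.
    rewrite big_ord_recr/= [c]splitr (le_lt_trans _ (ltrD FB FC))//.
    by apply: sd_setU; [exact: mFn|exact: mF|exact: mU|exact: mU].
  exists B => //; apply: (@le_lt_trans _ _ (sd (\bigcup_k F k) (\big[setU/set0]_(k < n) F k) +
    sd (\big[setU/set0]_(k < n) F k) B)); last by rewrite [ltRHS]splitr ltrD.
  by apply: sd_tri; [exact: bigcupT_measurable|exact: mFn|exact: mU].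
Qed.

End measure_algebra.
#[global] Hint Resolve measurable_setY : core.

(** * Polish distances on standard Borel spaces *)

Section standard_borel_distance.
Context {d : measure_display} {X : measurableType d} {R : realType}.

(** A distance and a dense sequence replace the bundled spaces of [standard_borel]; [dopen] then
    plays the role of the topology. *)
Record polish_dist (D : X -> X -> R) (z : nat -> X) : Prop := PolishDist {
  polish_pseudo_dist : pseudo_dist D;
  polish_separated : forall x y, D x y = 0 -> x = y;
  polish_complete : dcomplete D;
  polish_dense : ddense D z;
  polish_measurable : (@measurable d X : set (set X)) = <<s dopen D >> }.

Lemma standard_borel_dist (x0 : X) : standard_borel X R ->
  exists D z, polish_dist D z.
Proof.
move=> [tau [[[Q cQ dQ] [M [cM [f [g [fK gK cf cg]]]]]] mX]].
pose S := with_topology tau.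
pose D (x y : X) := mdist (f (x : S)) (f (y : S)).
have ballD (x y : X) (e : R) : ball (f x) e (f y) <-> D x y < e by rewrite ballEmdist.
have pD : pseudo_dist D.
  by split=> *; [exact: mdistxx|exact: metric_sym|exact: metric_triangle].
have openD : dopen D = @open S.
  apply/seteqP; split=> U.
    move=> oU; have -> : U = f @^-1` [set m | U (g m)].
      by apply/seteqP; split=> x /=; rewrite fK.
    apply: open_comp => [x _|]; first exact: cf.
    rewrite openE => m /= Um; have [e e0 He] := oU _ Um.
    apply/nbhs_ballP; exists e => //= y my; apply: He.
    by rewrite -ballD !gK.
  move=> oU x Ux; have : nbhs (f x) (g @^-1` U).
    by apply: open_nbhs_nbhs; split; [apply: open_comp => // ? _; exact: cg|rewrite /= fK].
  move=> /nbhs_ballP[e /= e0 He]; exists e => // y xy.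
  by have /= := He (f y); rewrite fK; apply; rewrite ballD.
have [z Hz] : exists z : nat -> X, ddense D z.
  have /pfcard_geP[Q0|[h]] := cQ.
    have := dQ setT; rewrite Q0 setI0 => -[||x []]; [by exists x0|exact: openT].
  exists h => x e e0.
  have [y [/= xy Qy]] : [set y : S | D x y < e] `&` Q !=set0.
    apply: dQ; first by exists x; rewrite /= (pdistxx pD).
    by rewrite -openD; exact: dopen_ball.
  by have [n _ hn] := @surj _ _ _ _ h y Qy; exists n; rewrite hn (pdistC pD).
exists D, z; split=> //.
- by move=> x y /mdist_positivity xy; rewrite -(fK x) xy fK.
- move=> u uc.
  have : cauchy (f \o u @ \oo).
    apply/cauchyP => e e0; have [N HN] := uc e e0.
    by exists (f (u N)); exists N => // n Nn /=; rewrite ballD HN.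
  move=> /(cM _ _)[l ul]; exists (g l); apply/(dcvgP pD) => e e0.
  have [N _ HN] := (cvg_ballP (f \o u) l).1 ul e e0; exists N => n Nn.
  by rewrite (pdistC pD) -ballD gK; exact: HN.
- by rewrite openD.
Qed.

End standard_borel_distance.

Section polish_probability.
Context {d : measure_display} {X : measurableType d} {R : realType}.
Variables (P : probability X R) (D : X -> X -> R) (z : nat -> X).
Hypothesis HD : polish_dist D z.
Let pD := polish_pseudo_dist HD.
Let D0 := polish_separated HD.
Let dz := polish_dense HD.
Let mX := polish_measurable HD.

Lemma dopen_measurable U : dopen D U -> measurable U.
Proof. by move=> oU; rewrite mX; exact: sub_sigma_algebra. Qed.

Lemma measurable_shrinking U n : measurable (shrinking D U n).
Proof.
rewrite -[X in measurable X]setCK; apply/measurableC/dopen_measurable.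
exact: dopen_shrinkingC.
Qed.

Definition base_ball (p : nat * nat) := [set x | D (z p.1) x < 2^-1 ^+ p.2].

Definition base_union (s : seq (nat * nat)) :=
  [set x | exists2 p, p \in s & base_ball p x].

(** Finite unions of balls, and not just balls, because these are dense in the measure algebra while
    still countably many. A number that codes no list yields the empty set. *)
Definition base_set (k : nat) :=
  if unpickle k is Some s then base_union s else set0.

Lemma base_setE s : base_set (pickle s) = base_union s.
Proof. by rewrite /base_set pickleK. Qed.

Lemma base_union1 p : base_union [:: p] = base_ball p.
Proof.
apply/seteqP; split=> x; first by move=> [q]; rewrite inE => /eqP ->.
by exists p => //; rewrite inE.
Qed.

Lemma dopen_base_union s : dopen D (base_union s).
Proof.
move=> x [p ps px]; have [e e0 H] := dopen_ball pD px.
by exists e => // y /H; exists p.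
Qed.

Lemma measurable_base_set k : measurable (base_set k).
Proof.
rewrite /base_set; case: unpickle => [s|]; last exact: measurable0.
exact/dopen_measurable/dopen_base_union.
Qed.
Hint Resolve measurable_base_set : core.

Lemma base_dense A e : measurable A -> 0 < e -> exists k, sd P A (base_set k) < e.
Proof.
pose U : set (set X) := range base_union.
have mU : U `<=` measurable.
  by move=> _ [s _ <-]; exact/dopen_measurable/dopen_base_union.
have U0 : U set0 by exists [::] => //; apply/seteqP; split=> x // [].
have UU A' B' : U A' -> U B' -> U (A' `|` B').
  move=> [s _ <-] [t _ <-]; exists (s ++ t) => //.
  apply/seteqP; split=> x.
    by move=> [p]; rewrite mem_cat => /orP[? ?|? ?]; [left|right]; exists p.
  by move=> [|] [p ps px]; exists p => //; rewrite mem_cat ps ?orbT.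
have openU O c : dopen D O -> 0 < c -> exists2 B, U B & sd P O B < c.
  move=> oO c0; pose G k := if (unpickle k : option (nat * nat)) is Some p then
    if pselect (base_ball p `<=` O) then base_ball p else set0 else set0.
  have UG k : U (G k).
    rewrite /G; case: unpickle => [p|//]; case: pselect => [pO|//].
    by exists [:: p]; rewrite ?base_union1.
  have OG : O = \bigcup_k G k.
    apply/seteqP; split=> x; last first.
      by move=> [k _]; rewrite /G; case: unpickle => [p|[]]; case: pselect => [pO /pO//|pO []].
    move=> Ox; have [a a0 Ha] := oO _ Ox.
    have [n Hn] := exprhalf_lt (divr_gt0 a0 (ltr0Sn _ 1)).
    have [i Hi] := dz x (exprhalf_gt0 n).
    exists (pickle (i, n)) => //; rewrite /G pickleK.
    case: pselect => [pO|[]]; first exact: Hi.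
    move=> y; rewrite /base_ball /= => iy; apply: Ha.
    rewrite (le_lt_trans (pdist_tri pD (z i) _ _))// (pdistC pD).
    by rewrite [a]splitr ltrD// (lt_trans _ Hn).
  have [n Hn] := @sd_small_bigcup _ _ _ P G (fun k => mU _ (UG k)) c c0.
  exists (\big[setU/set0]_(k < n) G k); last by rewrite {1}OG.
  by elim/big_ind : _.
(* The complement of an open [V] is closed, but differs little from the complement of a large closed
   [shrinking D V N], which is open and thus approximable by [openU]. *)
have UC A' : U A' -> forall c, 0 < c -> exists2 B, U B & sd P (~` A') B < c.
  move=> [s _ <-] c c0; pose V := base_union s.
  have oV : dopen D V := dopen_base_union (s := s).
  have /cvg0P H := @sd_cvg_bigcup _ _ _ P (shrinking D V)
    (measurable_shrinking V) (@shrinking_homo _ _ D V).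
  have [N HN] := H (fun=> sd_ge0 _ _ _) (c / 2) (divr_gt0 c0 (ltr0Sn _ 1)).
  have [B UB VB] := openU _ _ (dopen_shrinkingC pD (U := V) (n := N)) (divr_gt0 c0 (ltr0Sn _ 1)).
  exists B => //; apply: (@le_lt_trans _ _ (sd P (~` V) (~` shrinking D V N) +
      sd P (~` shrinking D V N) B)).
    apply: sd_tri; last exact: mU.
      exact/measurableC/dopen_measurable.
    exact/measurableC/measurable_shrinking.
  rewrite sd_setC [c]splitr ltrD//.
  by have := HN N (leqnn N); rewrite bigcup_shrinking.
move=> mA e0; have SA := approximable_sigma_algebra (P := P) mU U0 UU UC.
have : <<s dopen D >> A by rewrite -mX.
move=> /(_ _ (conj SA _))[|_ /(_ e e0)[_ [s _ <-] As]].
  by move=> O oO; split; [exact: dopen_measurable|move=> c c0; exact: openU].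
by exists (pickle s); rewrite base_setE.
Qed.

Definition adist (A : set X) (f g : X -> X) := sd P (f @^-1` A) (g @^-1` A).

(** The base contains arbitrarily small balls, so that [f x] and [g x] are at distance 0 once they
    lie in the same base sets. *)
Lemma ae_eq_base (f g : X -> X) : measurable_fun setT f -> measurable_fun setT g ->
  (forall k, adist (base_set k) f g = 0) -> \forall x \ae P, f x = g x.
Proof.
move=> mf mg fg.
have : \forall x \ae P, forall k, base_set k (f x) <-> base_set k (g x).
  apply/ae_foralln => k; have /sd_ae := fg k.
  by apply; exact: preimage_measurable.
apply: filterS => x H; apply: D0; apply/eqP; rewrite eq_le (pdist_ge0 pD) andbT.
apply/ler_addgt0Pr => e e0; rewrite add0r.
have [n Hn] := exprhalf_lt (divr_gt0 e0 (ltr0Sn _ 1)).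
have [i Hi] := dz (f x) (exprhalf_gt0 n).
have := H (pickle [:: (i, n)]); rewrite base_setE base_union1 => -[/(_ Hi)].
rewrite /base_ball /= => Hg _; apply/ltW.
rewrite (le_lt_trans (pdist_tri pD (z i) _ _))// (pdistC pD).
by rewrite [e]splitr ltrD// (lt_trans _ Hn).
Qed.

Lemma adist_ae A (f g : X -> X) : measurable_fun setT f -> measurable_fun setT g ->
  measurable A -> (\forall x \ae P, f x = g x) -> adist A f g = 0.
Proof.
move=> mf mg mA fg; apply/sd_ae; [exact: preimage_measurable..|].
by apply: filterS fg => x /= ->.
Qed.

Lemma adist_tri A (g f h : X -> X) : measurable_fun setT f -> measurable_fun setT g ->
  measurable_fun setT h -> measurable A -> adist A f h <= adist A f g + adist A g h.
Proof. by move=> mf mg mh mA; apply: sd_tri; exact: preimage_measurable. Qed.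

Lemma adistC A f g : adist A f g = adist A g f. Proof. exact: sd_sym. Qed.

Lemma adist_ge0 A f g : 0 <= adist A f g. Proof. exact: sd_ge0. Qed.

Lemma adist_compr A (f g h : X -> X) : measurable_fun setT f -> measurable_fun setT g ->
  measurable_fun setT h -> preserves P h -> measurable A ->
  adist A (f \o h) (g \o h) = adist A f g.
Proof.
by move=> mf mg mh ph mA; apply: (sd_preimage mh ph); exact: preimage_measurable.
Qed.

(* On measure-preserving maps this metrizes the weak topology. *)
Definition wdist (f g : X -> X) : R :=
  sup [set 2^-1 ^+ k * adist (base_set k) f g | k in [set: nat]].

Section measurable_maps.
Variables f g : X -> X.
Hypotheses (mf : measurable_fun setT f) (mg : measurable_fun setT g).

Lemma adist_le1 A : measurable A -> adist A f g <= 1.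
Proof.
move=> mA; apply: pr_le1; apply: measurable_setY; exact: preimage_measurable.
Qed.

Lemma wdist_le c : (forall k, 2^-1 ^+ k * adist (base_set k) f g <= c) ->
  wdist f g <= c.
Proof.
move=> H; apply: ge_sup => [|_ [k _ <-]//].
by exists (2^-1 ^+ 0 * adist (base_set 0) f g), 0%N.
Qed.

Lemma le_wdist k : 2^-1 ^+ k * adist (base_set k) f g <= wdist f g.
Proof.
apply: ub_le_sup; last by exists k.
exists 1 => _ [l _ <-]; rewrite mulr_ile1 ?adist_ge0 ?adist_le1//.
by rewrite exprn_ile1// invf_le1// ler1n.
Qed.

(** The terms from [n] on are at most [2^-1 ^+ n] because [adist] is at most 1. *)
Lemma wdist_lt e n : (forall k, (k < n)%N -> adist (base_set k) f g <= e) ->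
  2^-1 ^+ n <= e -> wdist f g <= e.
Proof.
move=> H ne; apply: wdist_le => k; have [kn|nk] := ltnP k n.
  rewrite (le_trans _ (H k kn))// ler_piMl ?adist_ge0//.
  by rewrite exprn_ile1// invf_le1// ler1n.
rewrite (le_trans _ ne)// (le_trans _ (ler_exprhalf nk))//.
by rewrite ler_piMr ?adist_le1// ltW// exprhalf_gt0.
Qed.

(** Since [f] and [g] preserve [P], replacing [A] by the base set costs [e] on either side; the
    [k]-th term of [wdist] accounts for the third [e]. *)
Lemma adist_lt A k e : preserves P f -> preserves P g -> measurable A ->
  sd P A (base_set k) < e -> wdist f g < 2^-1 ^+ k * e -> adist A f g < 3 * e.
Proof.
move=> pf pg mA Ak; have mk := @measurable_base_set k.
move=> fge; have : adist (base_set k) f g < e.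
  by rewrite -(ltr_pM2l (@exprhalf_gt0 R k)) (le_lt_trans (le_wdist k)).
have h1 : sd P (f @^-1` A) (f @^-1` base_set k) < e by rewrite sd_preimage.
have h2 : sd P (g @^-1` base_set k) (g @^-1` A) < e.
  by rewrite sd_preimage// sd_sym.
have mpre (h : X -> X) (B : set X) : measurable_fun setT h -> measurable B ->
  measurable (h @^-1` B) by exact: preimage_measurable.
have := @sd_tri _ _ _ P (f @^-1` base_set k) (f @^-1` A) (g @^-1` A)
  (mpre _ _ mf mA) (mpre _ _ mf mk) (mpre _ _ mg mA).
have := @sd_tri _ _ _ P (g @^-1` base_set k) (f @^-1` base_set k) (g @^-1` A)
  (mpre _ _ mf mk) (mpre _ _ mg mk) (mpre _ _ mg mA).
rewrite /adist; lra.
Qed.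

End measurable_maps.

Lemma wdist_cvg (f : nat -> X -> X) (g : X -> X) :
  (forall n, measurable_fun setT (f n)) -> measurable_fun setT g ->
  (forall A, measurable A -> (fun n => adist A (f n) g) @ \oo --> (0 : R)) ->
  (fun n => wdist (f n) g) @ \oo --> (0 : R).
Proof.
move=> mf mg fg.
have w0 n : 0 <= wdist (f n) g.
  by apply: le_trans (le_wdist _ _ 0%N) => //; rewrite mulr_ge0// adist_ge0.
apply/(cvg0P w0) => e e0.
have [n Hn] := exprhalf_lt (divr_gt0 e0 (ltr0Sn _ 1)).
have H k : exists N, forall m, (N <= m)%N -> adist (base_set k) (f m) g < e / 2.
  have /cvg0P := fg _ (@measurable_base_set k); apply; last by rewrite divr_gt0.
  by move=> m; exact: adist_ge0.
have [N HN] := choice H; exists (\sum_(k < n) N k)%N => m Nm.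
rewrite (@le_lt_trans _ _ (e / 2))//; last by rewrite gtr_pMr// invf_lt1// ltr1n.
apply: (@wdist_lt _ _ _ _ _ n) => //; last exact: ltW.
move=> k kn; apply/ltW/HN; rewrite (leq_trans _ Nm)//.
by rewrite (bigD1 (Ordinal kn))//= leq_addr.
Qed.

End polish_probability.

(** * Almost sure limits of measure-preserving maps *)

Section limits_of_maps.
Context {d : measure_display} {X : measurableType d} {R : realType}.
Variables (P : probability X R) (D : X -> X -> R) (z : nat -> X).
Hypothesis HD : polish_dist D z.
Let pD := polish_pseudo_dist HD.
Let cD := polish_complete HD.
Let dz := polish_dense HD.
Let mX := polish_measurable HD.

(** Fatou's lemma for sets. *)
Lemma pr_liminf_le (F : nat -> set X) c : (forall n, measurable (F n)) ->
  (forall n, pr P (F n) <= c) ->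
  pr P (\bigcup_n \bigcap_(j in [set j | (n <= j)%N]) F j) <= c.
Proof.
move=> mF Fc; pose G n := \bigcap_(j in [set j | (n <= j)%N]) F j.
have mG n : measurable (G n) by apply: bigcap_measurableType => k _.
have mU : measurable (\bigcup_n G n) by exact: bigcupT_measurable.
rewrite -subr_le0; apply: (@cvg0_le0 _ _ (fun n => sd P (\bigcup_k G k) (G n))).
  move=> n; rewrite sd_sym sd_subset//; last exact: bigcup_sup.
  rewrite lerB// (le_trans _ (Fc n))// pr_le// => x; apply.
  exact: leqnn.
apply: sd_cvg_bigcup => // m n mn x Gx j /= nj; apply: Gx => /=.
exact: leq_trans nj.
Qed.

(** The Borel-Cantelli lemma for geometrically decreasing probabilities. *)
Lemma summable_limsup0 (F : nat -> set X) c : (forall n, measurable (F n)) ->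
  (forall n, pr P (F n) <= c * 2^-1 ^+ n) -> P (lim_sup_set F) = 0%E.
Proof.
move=> mF Fc; apply: lim_sup_set_cvg0 => //.
apply: (@le_lt_trans _ _ (c * 2)%:E); last exact: ltry.
apply: lime_le; first exact: is_cvg_nneseries.
apply: nearW => n; rewrite (@le_trans _ _ (c * 2 - c * 2 * 2^-1 ^+ n)%:E)//.
  elim: n => [|n IH]; first by rewrite big_geq// expr0 mulr1 subrr.
  rewrite big_nat_recr//= (le_trans (leeD IH (lexx _)))// prE// -EFinD lee_fin.
  by have := Fc n; rewrite exprS; lra.
rewrite lee_fin gerBl mulr_ge0// ?(ltW (exprhalf_gt0 _))// mulr_ge0//.
by rewrite (le_trans (pr_ge0 P (F 0%N)))// (le_trans (Fc 0%N))// expr0 mulr1.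
Qed.

Variable T : nat -> X -> X.
Hypotheses (mT : forall n, measurable_fun setT (T n)) (pT : forall n, preserves P (T n)).
Hypothesis TT : forall n, wdist P D z (T n) (T n.+1) <= (2^-1 ^+ n) ^+ 2.

(** [W j] is where [T j x] and [T j.+1 x] are on different sides of the base set; by Borel-Cantelli
    almost every [x] lies in finitely many of these sets. *)
Lemma near_eventually_const : \forall x \ae P, forall i, exists n, forall j,
  (n <= j)%N -> base_set D z i (T j x) <-> base_set D z i (T n x).
Proof.
apply/ae_foralln => i.
pose W j := (T j @^-1` base_set D z i) `+` (T j.+1 @^-1` base_set D z i).
have mi := measurable_base_set HD i.
have mW j : measurable (W j).
  by apply: measurable_setY; exact: preimage_measurable.
have W0 : P (lim_sup_set W) = 0%E.
  apply: (@summable_limsup0 _ (2 ^+ i)) => // j.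
  have := le_trans (le_wdist P HD (mT j) (mT j.+1) i) (TT j).
  rewrite exprVn ler_pdivrMl ?exprn_gt0// => H; rewrite (le_trans H)//.
  rewrite ler_wpM2l ?exprn_ge0// exprS expr1 ler_piMl ?(ltW (exprhalf_gt0 _))//.
  by rewrite exprn_ile1// invf_le1// ler1n.
exists (lim_sup_set W); split=> //.
  by apply: bigcapT_measurable => n; exact: bigcup_measurable.
move=> x /= /forallNP nx; apply: contrapT => /existsNP[n /not_implyP[_ nW]].
apply: (nx n) => j; elim: j => [|j IH nj]; first by rewrite leqn0 => /eqP ->.
move: nj; rewrite leq_eqVlt => /orP[/eqP <-//|nj].
rewrite -IH//; have /not_in_setY /= -> // : ~ W j x.
by move=> Wjx; apply: nW; exists j.
Qed.

(** Measure preservation gives tightness: [L n], the points whose images finally stay outside the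
    first [n] balls, has probability at most that of the complement of these balls, which tends to
    0. Off the intersection of the [L n], the images keep returning to finitely many balls, and by
    eventual constancy they remain in one of them. *)
Lemma near_eventually_ball l : \forall x \ae P,
  exists a n, forall j, (n <= j)%N -> D (z a) (T j x) < 2^-1 ^+ l.
Proof.
pose F n := base_union D z [seq (a, l) | a <- iota 0 n].
have FE n x : F n x <-> exists2 a, (a < n)%N & D (z a) x < 2^-1 ^+ l.
  split=> [[_ /mapP[a + ->]]|[a an ax]].
    by rewrite mem_iota /= add0n => an ax; exists a.
  by exists (a, l) => //; apply/mapP; exists a => //; rewrite mem_iota.
have mF n : measurable (F n) by exact/(dopen_measurable HD)/dopen_base_union.
pose L n := \bigcup_m \bigcap_(j in [set j | (m <= j)%N]) (T j @^-1` (~` F n)).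
have mL n : measurable (L n).
  apply: bigcupT_measurable => m; apply: bigcap_measurableType => j _.
  by apply: preimage_measurable => //; exact: measurableC.
have prL n : pr P (L n) <= pr P (~` F n).
  apply: pr_liminf_le => m.
    by apply: preimage_measurable => //; exact: measurableC.
  by rewrite /pr pT//; exact: measurableC.
have mcap : measurable (\bigcap_n L n) by exact: bigcapT_measurable.
have L0 : P (\bigcap_n L n) = 0%E.
  rewrite prE//; congr EFin; apply/eqP; rewrite eq_le pr_ge0 andbT.
  have FT : \bigcup_n F n = setT.
    apply/seteqP; split=> // x _; have [a ax] := dz x (exprhalf_gt0 l).
    by exists a.+1 => //; apply/FE; exists a.
  apply: (@cvg0_le0 _ _ (fun n => sd P (\bigcup_k F k) (F n))) => [n|].
    rewrite FT -sd_setC setCT sd_subset//; last exact: measurableC.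
    rewrite {3}/pr measure0 subr0 (le_trans _ (prL n))// pr_le//.
    exact: bigcap_inf.
  apply: sd_cvg_bigcup => // m n mn x /FE[a am ax].
  by apply/FE; exists a => //; exact: leq_trans mn.
have nL : \forall x \ae P, ~ (\bigcap_n L n) x.
  by exists (\bigcap_n L n); split => // x /= /contrapT.
apply: filterS2 nL near_eventually_const => x /existsNP[n /not_implyP[_ nLx]] cst.
have [N HN] := choice cst.
apply: contrapT => /forallNP nball; apply: nLx.
exists (\sum_(a < n) N (pickle [:: (val a, l)]))%N => // j /= Nj /FE[a an ax].
have Na : (N (pickle [:: (a, l)]) <= j)%N.
  by rewrite (leq_trans _ Nj)// (bigD1 (Ordinal an))//= leq_addr.
apply: (nball a); exists (N (pickle [:: (a, l)])) => k Nk.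
have baseE y : base_set D z (pickle [:: (a, l)]) y <-> D (z a) y < 2^-1 ^+ l.
  by rewrite base_setE base_union1.
by apply/baseE/HN => //; apply/(HN _ j) => //; exact/baseE.
Qed.

Lemma near_dcauchy : \forall x \ae P, dcauchy D (fun j => T j x).
Proof.
have /ae_foralln := near_eventually_ball; apply: filterS => x H e e0.
have [l Hl] := exprhalf_lt (divr_gt0 e0 (ltr0Sn _ 1)).
have [a [n an]] := H l; exists n => i j ni nj.
rewrite (le_lt_trans (pdist_tri pD (z a) _ _))// (pdistC pD).
by rewrite [e]splitr ltrD// (lt_trans _ Hl)// an.
Qed.

Lemma exists_limit_map : exists f : X -> X, measurable_fun setT f /\
  \forall x \ae P, dcvg D (fun j => T j x) (f x).
Proof.
have [N [mN N0 HN]] := near_dcauchy.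
have lim0 x : exists l, ~ N x -> dcvg D (fun j => T j x) l.
  have [Nx|nNx] := pselect (N x); first by exists x.
  have /cD[l xl] : dcauchy D (fun j => T j x) by apply: contrapT => /HN.
  by exists l.
have [g Hg] := choice lim0.
(* The identity on the null set [N] keeps [f] measurable. *)
pose f x := if pselect (N x) then x else g x.
exists f; split; last first.
  exists N; split => // x /= nx; apply: contrapT => Nx; apply: nx.
  by rewrite /f; case: pselect => // Nx'; exact: Hg.
apply: (@measurability _ _ X X setT f (dopen D) mX) => _ [U oU <-]; rewrite setTI.
(* Off [N], the limit is in [U] exactly when the images eventually stay in one [shrinking D U m]:
   these sets are closed, and each point of [U] has a neighbourhood inside one of them. *)
pose L := \bigcup_m \bigcup_n \bigcap_(j in [set j | (n <= j)%N])
  (T j @^-1` shrinking D U m).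
have mL : measurable L.
  apply: bigcupT_measurable => m; apply: bigcupT_measurable => n.
  apply: bigcap_measurableType => j _; apply: preimage_measurable => //.
  exact: (measurable_shrinking HD).
suff -> : f @^-1` U = (N `&` U) `|` (L `\` N).
  apply: measurableU; last exact: measurableD.
  by apply: measurableI => //; exact: (dopen_measurable HD).
apply/seteqP; split=> x; rewrite /f /=.
  case: pselect => [Nx Ux|nNx Ux]; first by left.
  right; split => //; have [n Hn] := near_shrinking pD oU Ux.
  have [M HM] := (dcvgP pD _ _).1 (Hg x nNx) _ (exprhalf_gt0 n).
  exists n => //; exists M => // j /= Mj; apply: Hn.
  by rewrite (pdistC pD) HM.
case: pselect => [Nx [[]//|[_ /(_ Nx)//]]|nNx [[]//|[[m _ [n _ H]] _]]].
have : shrinking D U m (g x).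
  apply: (@dclosed_shrinking _ _ _ pD U m (fun j => T (n + j)%N x)).
    by move=> j; apply: H => /=; rewrite leq_addr.
  have := @cvg0_sub _ _ (fun j => (n + j)%N) _ (Hg x nNx); apply => j.
  exact: leq_addl.
by apply; rewrite (pdistxx pD) exprhalf_gt0.
Qed.

Section limit_map.
Variable f : X -> X.
Hypotheses (mf : measurable_fun setT f)
  (fT : \forall x \ae P, dcvg D (fun j => T j x) (f x)).

Let B U n := \bigcap_(j in [set j | (n <= j)%N]) (T j @^-1` U).

Let mB U n : dopen D U -> measurable (B U n).
Proof.
move=> oU; apply: bigcap_measurableType => j _.
exact/preimage_measurable/(dopen_measurable HD).
Qed.

Let near_liminf U : dopen D U ->
  \forall x \ae P, U (f x) -> (\bigcup_n B U n) x.
Proof.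
move=> oU; apply: filterS fT => x xf /oU[e e0 He].
have [N HN] := (dcvgP pD _ _).1 xf e e0.
by exists N => // j /= Nj; apply: He; rewrite (pdistC pD) HN.
Qed.

Let pr_preimage_le U : dopen D U ->
  pr P (f @^-1` U) <= pr P (\bigcup_n B U n) /\ pr P (\bigcup_n B U n) <= pr P U.
Proof.
move=> oU; have mU := dopen_measurable HD oU.
have mBU : measurable (\bigcup_n B U n).
  by apply: bigcupT_measurable => n; exact: mB.
have mfU := preimage_measurable mf mU.
split; last first.
  apply: pr_liminf_le => n; first exact: preimage_measurable.
  by rewrite /pr pT.
rewrite -subr_le0; have [N [mN N0 HN]] := near_liminf oU.
have -> : 0 = pr P N by rewrite /pr N0.
rewrite lerBlDl (le_trans _ (pr_setU_le P mBU mN))// pr_le//; first exact: measurableU.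
move=> x Ux; have [Nx|nNx] := pselect (N x); first by right.
left; have /not_implyP := fun h => nNx (HN x h).
by apply: contrapT => nBx; apply: nNx; apply: HN => /(_ Ux).
Qed.

(** The inequality [pr_preimage_le] for the open complement of [shrinking D U n] gives the reverse
    inequality for that closed set, and these sets increase to [U]. *)
Let pr_preimage U : dopen D U -> pr P (f @^-1` U) = pr P U.
Proof.
move=> oU; have mU := dopen_measurable HD oU.
apply/eqP; rewrite eq_le (le_trans (pr_preimage_le oU).1 (pr_preimage_le oU).2)/=.
have msh n := measurable_shrinking HD U n.
rewrite -subr_le0; apply: (@cvg0_le0 _ _
    (fun n => sd P (\bigcup_k shrinking D U k) (shrinking D U n))); last first.
  by apply: sd_cvg_bigcup => //; exact: shrinking_homo.
move=> n; rewrite bigcup_shrinking// sd_sym.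
have sU : shrinking D U n `<=` U.
  by rewrite -[X in _ `<=` X](bigcup_shrinking pD oU); exact: bigcup_sup.
rewrite sd_subset// lerB//.
have oC := dopen_shrinkingC pD (U := U) (n := n).
have := le_trans (pr_preimage_le oC).1 (pr_preimage_le oC).2.
rewrite -preimage_setC !pr_setC//; last exact: preimage_measurable.
rewrite lerD2l lerN2 => /le_trans; apply.
by apply: pr_le; [exact: preimage_measurable..|exact: preimage_subset].
Qed.

(** The liminf, the union of the [B U n], contains the preimage of [U] under [f] up to a null set
    and has the same probability, so the two agree. Its increasing approximation [B U n] is
    contained in the preimage of [U] under [T n], whose probability is that of [U] too. *)
Let adist_dopen U : dopen D U -> (fun n => adist P U (T n) f) @ \oo --> (0 : R).
Proof.
move=> oU; have mU := dopen_measurable HD oU.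
have mBU : measurable (\bigcup_n B U n).
  by apply: bigcupT_measurable => n; exact: mB.
have [fB BU] := pr_preimage_le oU.
have UB : pr P (\bigcup_n B U n) = pr P U.
  by apply/eqP; rewrite eq_le BU -(pr_preimage oU) fB.
have mfU := preimage_measurable mf mU.
have sd0 : sd P (f @^-1` U) (\bigcup_n B U n) = 0.
  pose C := (f @^-1` U) `&` \bigcup_n B U n.
  have mC : measurable C by exact: measurableI.
  have fC : sd P (f @^-1` U) C = 0.
    apply/sd_ae => //; apply: filterS (near_liminf oU) => x H.
    by split=> [fx|[]//]; split=> //; exact: H.
  have CB : sd P C (\bigcup_n B U n) = 0.
    rewrite sd_subset//; last exact: subIsetr.
    have : pr P C = pr P (f @^-1` U).
      apply/eqP; rewrite -subr_eq0 -normr_le0 -fC sd_sym.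
      exact: ler_pr_sd.
    by move=> ->; rewrite UB pr_preimage// subrr.
  apply/eqP; rewrite eq_le sd_ge0 andbT.
  by rewrite (le_trans (sd_tri P mfU mC mBU))// fC CB addr0.
apply: (@le_cvg0 _ _ (fun n => sd P (\bigcup_k B U k) (B U n) +
    sd P (\bigcup_k B U k) (B U n))); last first.
  apply: cvg0D; apply: sd_cvg_bigcup => [n|m n mn x Bx j /= nj].
  - exact: mB.
  - by apply: Bx => /=; exact: leq_trans nj.
  - exact: mB.
  - by apply: Bx => /=; exact: leq_trans nj.
move=> n; rewrite adist_ge0/= /adist.
have mTU := preimage_measurable (mT n) mU.
have mBn := @mB U n oU.
have TB : sd P (T n @^-1` U) (B U n) = sd P (\bigcup_k B U k) (B U n).
  rewrite sd_sym sd_subset//; last by move=> x; apply => /=.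
  rewrite [RHS]sd_sym sd_subset//; last exact: bigcup_sup.
  by rewrite UB /pr pT.
rewrite (le_trans (sd_tri P mTU mBn mfU))// TB lerD2l.
rewrite (le_trans (sd_tri P mBn mBU mfU))// sd_sym.
by rewrite [X in _ + X]sd_sym sd0 addr0.
Qed.

Lemma limit_map_adist A : measurable A ->
  (fun n => adist P A (T n) f) @ \oo --> (0 : R).
Proof.
pose Q := [set E : set X | measurable E /\
  (fun n => adist P E (T n) f) @ \oo --> (0 : R)].
suff SQ : sigma_algebra setT Q.
  move=> mA; have : <<s dopen D >> A by rewrite -mX.
  move=> /(_ Q (conj SQ _))[|//] U oU.
  by split; [exact: (dopen_measurable HD)|exact: adist_dopen].
have mpre (h : X -> X) (E : set X) : measurable_fun setT h -> measurable E ->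
  measurable (h @^-1` E) by exact: preimage_measurable.
split.
- split=> //; rewrite (_ : (fun n => _) = cst 0); first exact: cvg_cst.
  by apply/funext => n; rewrite /adist !preimage_set0 sdxx.
- move=> E [mE HE]; rewrite setTD; split; first exact: measurableC.
  rewrite (_ : (fun n => _) = (fun n => adist P E (T n) f))//.
  by apply/funext => n; rewrite /adist -!preimage_setC sd_setC.
- move=> F HF; have mF n : measurable (F n) by have [] := HF n.
  pose G n := \big[setU/set0]_(k < n) F k.
  have mG n : measurable (G n) by exact: bigsetU_measurable.
  have mUF : measurable (\bigcup_n F n) by exact: bigcupT_measurable.
  split=> //.
  have UG : \bigcup_n F n = \bigcup_n G n.
    apply/seteqP; split=> [x [k _ Fx]|x [k _]]; last exact: bigsetU_bigcup.
    by exists k.+1 => //; rewrite /G big_ord_recr/=; right.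
  have GT n : (fun j => adist P (G n) (T j) f) @ \oo --> (0 : R).
    elim: n => [|n IH].
      rewrite (_ : (fun n => _) = cst 0); first exact: cvg_cst.
      by apply/funext => n; rewrite /adist /G big_ord0 !preimage_set0 sdxx.
    apply: le_cvg0 (cvg0D IH (HF n).2) => j; rewrite adist_ge0/=.
    rewrite /adist /G big_ord_recr/= !preimage_setU; rewrite -/(G n).
    by apply: sd_setU; auto.
  have ndG : {homo G : m n / (m <= n)%N >-> m `<=` n} by exact: subset_bigsetU.
  have /cvg0P H1 := @sd_cvg_bigcup _ _ _ P G mG ndG.
  have /cvg0P H2 := @sd_cvg_bigcup _ _ _ P (fun n => f @^-1` G n)
    (fun n => mpre _ _ mf (mG n)) (fun m n mn => preimage_subset (ndG m n mn)).
  apply/cvg0P => [n|e e0]; first exact: adist_ge0.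
  have e3 : 0 < e / 3 by rewrite divr_gt0.
  have [N1 HN1] := H1 (fun=> sd_ge0 _ _ _) _ e3.
  have [N2 HN2] := H2 (fun=> sd_ge0 _ _ _) _ e3.
  pose N := maxn N1 N2.
  have /cvg0P H3 := GT N; have [M HM] := H3 (fun=> adist_ge0 _ _ _ _) _ e3.
  exists M => j Mj; rewrite /adist.
  have h1 : sd P (T j @^-1` \bigcup_n F n) (T j @^-1` G N) < e / 3.
    by rewrite sd_preimage// UG HN1// leq_maxl.
  have h2 : sd P (f @^-1` G N) (f @^-1` \bigcup_n F n) < e / 3.
    by rewrite UG sd_sym preimage_bigcup HN2// leq_maxr.
  have := sd_tri P (mpre _ _ (mT j) mUF) (mpre _ _ (mT j) (mG N)) (mpre _ _ mf mUF).
  have := sd_tri P (mpre _ _ (mT j) (mG N)) (mpre _ _ mf (mG N)) (mpre _ _ mf mUF).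
  have := HM j Mj; rewrite /adist; lra.
Qed.

Lemma limit_map_preserves : preserves P f.
Proof.
move=> A mA; have mfA := preimage_measurable mf mA.
rewrite !prE//; congr EFin; apply/eqP; rewrite -subr_eq0 -normr_le0.
apply: cvg0_le0 (limit_map_adist mA) => n.
have <- : pr P (T n @^-1` A) = pr P A by rewrite /pr pT.
rewrite distrC; apply: ler_pr_sd => //; exact: preimage_measurable.
Qed.

End limit_map.

End limits_of_maps.

Section small_codes.
Context {R : realType}.

(* A form of separability inherited by arbitrary subspaces. *)
Definition small_codes (Z : Type) (D : Z -> Z -> R) :=
  forall n, exists c : Z -> nat, forall x y, c x = c y -> D x y <= 2^-1 ^+ n.

Lemma small_codes_ddense (Z : Type) (D : Z -> Z -> R) : Z -> small_codes D ->
  exists z, ddense D z.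
Proof.
move=> x0 /choice[c Hc].
have pick (p : nat * nat) : exists x : Z, forall y, c p.1 y = p.2 -> c p.1 x = p.2.
  have [[y cy]|ny] := pselect (exists y, c p.1 y = p.2); first by exists y.
  by exists x0 => y cy; case: ny; exists y.
have [g Hg] := choice pick.
exists (fun k => if unpickle k is Some p then g p else x0) => x e e0.
have [n Hn] := exprhalf_lt e0; exists (pickle (n, c n x)); rewrite pickleK.
by apply: le_lt_trans Hn; apply: Hc; rewrite (Hg (n, c n x) x).
Qed.

Lemma small_codesD (Z : Type) (D1 D2 : Z -> Z -> R) : small_codes D1 ->
  small_codes D2 -> small_codes (fun x y => D1 x y + D2 x y).
Proof.
move=> h1 h2 n; have [c1 H1] := h1 n.+1; have [c2 H2] := h2 n.+1.
exists (fun x => pickle (c1 x, c2 x)) => x y /(pcan_inj pickleK)[/H1 + /H2].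
rewrite !exprS; lra.
Qed.

Lemma small_codes_comp (Z Z' : Type) (f : Z' -> Z) (D : Z -> Z -> R) :
  small_codes D -> small_codes (fun x y => D (f x) (f y)).
Proof. by move=> h n; have [c H] := h n; exists (c \o f) => x y /H. Qed.

Lemma small_codes_real : small_codes (fun x y : R => `|x - y|).
Proof.
move=> n; exists (fun x => pickle (Num.floor (2 ^+ n * x))) => x y.
move=> /(pcan_inj pickleK) xy; have p0 : 0 < 2 ^+ n :> R by rewrite exprn_gt0.
rewrite exprVn -[X in _ <= X]mulr1 ler_pdivlMl// -{1}(ger0_norm (ltW p0)) -normrM mulrBr.
have := floor_le (2 ^+ n * x); have := floorD1_gt (2 ^+ n * x).
have := floor_le (2 ^+ n * y); have := floorD1_gt (2 ^+ n * y).
rewrite xy intrD => *; rewrite ler_norml; apply/andP; split; lra.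
Qed.

End small_codes.

(** * A complete separable distance on automorphisms *)

Section automorphism_distance.
Context {d : measure_display} {X : measurableType d} {R : realType}.
Variables (P : probability X R) (D : X -> X -> R) (z : nat -> X).
Hypothesis HD : polish_dist D z.
Notation wd := (wdist P D z).
Notation bset := (base_set D z).
Let mbase k : measurable (bset k). Proof. exact: (measurable_base_set HD). Qed.

Lemma wdist_ge0 (f g : X -> X) : measurable_fun setT f -> measurable_fun setT g ->
  0 <= wd f g.
Proof.
move=> mf mg; apply: le_trans (le_wdist P HD mf mg 0).
by rewrite mulr_ge0// adist_ge0.
Qed.

Lemma wdistC (f g : X -> X) : wd f g = wd g f.
Proof. by rewrite /wdist; under eq_imagel do rewrite adistC. Qed.

Lemma wdist_tri (g f h : X -> X) : measurable_fun setT f -> measurable_fun setT g ->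
  measurable_fun setT h -> wd f h <= wd f g + wd g h.
Proof.
move=> mf mg mh; apply: wdist_le => k.
apply: le_trans (lerD (le_wdist P HD mf mg k) (le_wdist P HD mg mh k)).
by rewrite -mulrDr ler_wpM2l ?(ltW (exprhalf_gt0 _))// adist_tri.
Qed.

Lemma wdist_compr (f g h : X -> X) : measurable_fun setT f -> measurable_fun setT g ->
  measurable_fun setT h -> preserves P h -> wd (f \o h) (g \o h) = wd f g.
Proof.
move=> mf mg mh ph; rewrite /wdist; congr sup.
by apply: eq_imagel => k _; rewrite adist_compr.
Qed.

Lemma wdist_ae0 (f g : X -> X) : measurable_fun setT f -> measurable_fun setT g ->
  (\forall x \ae P, f x = g x) -> wd f g = 0.
Proof.
move=> mf mg fg; apply/eqP; rewrite eq_le wdist_ge0// andbT.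
by apply: wdist_le => k; rewrite adist_ae// mulr0.
Qed.

Lemma wdist_ae (f g f' g' : X -> X) : measurable_fun setT f -> measurable_fun setT g ->
  measurable_fun setT f' -> measurable_fun setT g' ->
  (\forall x \ae P, f x = f' x) -> (\forall x \ae P, g x = g' x) ->
  wd f g = wd f' g'.
Proof.
move=> mf mg mf' mg' ff' gg'.
have ff0 := wdist_ae0 mf mf' ff'; have gg0 := wdist_ae0 mg mg' gg'.
apply/eqP; rewrite eq_le; apply/andP; split.
  apply: (le_trans (wdist_tri mf mf' mg)); rewrite ff0 add0r.
  by apply: (le_trans (wdist_tri mf' mg' mg)); rewrite [wd g' g]wdistC gg0 addr0.
apply: (le_trans (wdist_tri mf' mf mg')); rewrite wdistC ff0 add0r.
by apply: (le_trans (wdist_tri mf mg mg')); rewrite gg0 addr0.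
Qed.

Lemma adist_continuous A e : measurable A -> 0 < e ->
  exists2 c, 0 < c & forall f g : X -> X, measurable_fun setT f ->
    measurable_fun setT g -> preserves P f -> preserves P g ->
    wd f g < c -> adist P A f g < e.
Proof.
move=> mA e0; have e3 : 0 < e / 3 by rewrite divr_gt0.
have [k Hk] := base_dense P HD mA e3.
exists (2^-1 ^+ k * (e / 3)); first by rewrite mulr_gt0// exprhalf_gt0.
move=> f g mf mg pf pg fg; rewrite (_ : e = 3 * (e / 3)); last by field.
exact: (adist_lt HD mf mg pf pg mA Hk fg).
Qed.

(** [adist] of [h \o f] and [h \o g] at [A] is [adist] of [f] and [g] at the preimage of [A] under
    [h], so finitely many sets have to be controlled. They depend on [h], and so does the modulus
    [c]; right composition, by contrast, is isometric. *)
Lemma wdist_compl_continuous (h : X -> X) e : measurable_fun setT h -> 0 < e ->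
  exists2 c, 0 < c & forall f g : X -> X, measurable_fun setT f ->
    measurable_fun setT g -> preserves P f -> preserves P g ->
    wd f g < c -> wd (h \o f) (h \o g) < e.
Proof.
move=> mh e0; have e2 : 0 < e / 2 by rewrite divr_gt0.
have [n Hn] := exprhalf_lt e2.
have [c c0 Hc] : exists2 c, 0 < c & forall f g : X -> X, measurable_fun setT f ->
    measurable_fun setT g -> preserves P f -> preserves P g ->
    wd f g < c -> forall k, (k < n)%N -> adist P (bset k) (h \o f) (h \o g) <= e / 2.
  elim: (n) => [|m [c c0 Hc]]; first by exists 1.
  have [c' c'0 Hc'] := adist_continuous (preimage_measurable mh (mbase m)) e2.
  exists (Num.min c c'); first by rewrite lt_min c0.
  move=> f g mf mg pf pg; rewrite lt_min => /andP[h1 h2] k.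
  rewrite ltnS leq_eqVlt => /orP[/eqP ->|km]; last exact: Hc.
  by apply/ltW; apply: Hc'.
exists c => // f g mf mg pf pg fg; rewrite (@le_lt_trans _ _ (e / 2))//.
  apply: (wdist_lt HD (measurableT_comp mh mf) (measurableT_comp mh mg) (n := n)).
    by move=> k kn; apply: Hc.
  exact: ltW.
by rewrite gtr_pMr// invf_lt1// ltr1n.
Qed.

Implicit Types S U V : automorphism P.

(** A [wdist]-limit of automorphisms can fail to be invertible; the second term prevents this, at
    the price of right invariance. *)
Definition aut_dist S U := wd S U + wd (aut_inv S) (aut_inv U).

Let mA S := measurable_aut S.
Let mI S := measurable_aut_inv S.
Let pA S := @aut_preserves _ _ _ _ S.
Let pI S := @aut_inv_preserves _ _ _ _ S.

Lemma aut_dist_pseudo : pseudo_dist aut_dist.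
Proof.
split=> [S|S U|S U V].
- by rewrite /aut_dist !wdist_ae0 ?addr0//; apply: aeW.
- by rewrite /aut_dist wdistC [X in _ + X]wdistC.
- by rewrite /aut_dist addrACA lerD// wdist_tri.
Qed.

Lemma wdist_le_aut S U : wd S U <= aut_dist S U.
Proof. by rewrite lerDl wdist_ge0. Qed.

Lemma aut_dist_inv S U : aut_dist (aut_sym S) (aut_sym U) = aut_dist S U.
Proof. by rewrite /aut_dist addrC. Qed.

(** [S] is coded by indices of base sets close to the preimages of the first [n] base sets; equal
    codes make these preimages close. *)
Lemma aut_dist_small_codes : small_codes aut_dist.
Proof.
have wcode : small_codes (fun S U => wd S U).
  move=> n; have [j Hj] := choice (fun p : nat * automorphism P =>
    base_dense P HD (preimage_measurable (mA p.2) (mbase p.1))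
      (exprhalf_gt0 (R := R) n.+1)).
  exists (fun S => pickle (mkseq (fun k => j (k, S)) n)) => S U.
  move=> /(pcan_inj pickleK) SU.
  apply: (wdist_lt HD (mA S) (mA U) (n := n)) => // k kn.
  have jj : j (k, S) = j (k, U).
    by rewrite -(nth_mkseq 0%N (fun k => j (k, S)) kn) SU nth_mkseq.
  have := Hj (k, S); have := Hj (k, U); rewrite /= jj => h1 h2.
  rewrite (le_trans (sd_tri P (preimage_measurable (mA S) (mbase k)) (mbase (j (k, U)))
    (preimage_measurable (mA U) (mbase k))))//.
  rewrite [X in _ + X]sd_sym; move: h1 h2; rewrite exprS; lra.
apply: small_codesD => //.
exact: (@small_codes_comp _ _ _ (@aut_sym _ _ _ P) _ wcode).
Qed.

Lemma aut_dist_complete : dcomplete aut_dist.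
Proof.
move=> u uc; have [k [nk Hk]] := fast_dcauchy uc.
pose T n := u (k n).
have TT n : wd (T n) (T n.+1) <= (2^-1 ^+ n) ^+ 2.
  exact: (le_trans (wdist_le_aut _ _) (ltW (Hk n))).
have IT n : wd (aut_inv (T n)) (aut_inv (T n.+1)) <= (2^-1 ^+ n) ^+ 2.
  apply: le_trans (wdist_le_aut (aut_sym _) (aut_sym _)) _.
  by rewrite aut_dist_inv; exact/ltW/Hk.
have [f [mf fT]] := exists_limit_map HD (fun n => mA (T n)) (fun n => @pA (T n)) TT.
have [g [mg gT]] := exists_limit_map HD (fun n => mI (T n)) (fun n => @pI (T n)) IT.
have fcv := limit_map_adist HD (fun n => mA (T n)) (fun n => @pA (T n)) mf fT.
have gcv := limit_map_adist HD (fun n => mI (T n)) (fun n => @pI (T n)) mg gT.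
have pf := limit_map_preserves HD (fun n => mA (T n)) (fun n => @pA (T n)) mf fT.
have pg := limit_map_preserves HD (fun n => mI (T n)) (fun n => @pI (T n)) mg gT.
(* Passage of [W n (V n x) = x] to the limit: [b \o a] is close to [b \o V n], which is close to
   [W n \o V n] because [V n] preserves [P]. *)
have inv (V : nat -> X -> X) (W : nat -> X -> X) (a b : X -> X) :
    (forall n, measurable_fun setT (V n)) -> (forall n, measurable_fun setT (W n)) ->
    (forall n, preserves P (V n)) ->
    measurable_fun setT a -> measurable_fun setT b ->
    (forall A, measurable A -> (fun n => adist P A (V n) a) @ \oo --> (0 : R)) ->
    (forall A, measurable A -> (fun n => adist P A (W n) b) @ \oo --> (0 : R)) ->
    (forall n, \forall x \ae P, W n (V n x) = x) -> \forall x \ae P, b (a x) = x.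
  move=> mV mW pV ma mb cV cW WV.
  apply: (ae_eq_base HD (measurableT_comp mb ma) (@measurable_id _ _ setT)) => i.
  apply/eqP; rewrite eq_le adist_ge0 andbT.
  have mi := preimage_measurable mb (mbase i).
  apply: (@cvg0_le0 _ _ (fun n => adist P (b @^-1` bset i) (V n) a +
    adist P (bset i) (W n) b)); last exact: cvg0D (cV _ mi) (cW _ (mbase i)).
  move=> n; have mWV := measurableT_comp (mW n) (mV n).
  have mbV := measurableT_comp mb (mV n).
  have mid := @measurable_id _ X setT.
  apply: (le_trans (adist_tri P (measurableT_comp mb ma) mbV mid (mbase i))).
  rewrite {1}adistC lerD//.
  apply: (le_trans (adist_tri P mbV mWV mid (mbase i))).
  rewrite (adist_compr mb (mW n) (mV n) (pV n) (mbase i)).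
  by rewrite (adist_ae mWV mid (mbase i) (WV n)) addr0 adistC.
have fK : \forall x \ae P, g (f x) = x.
  apply: (inv (fun n => aut_fun (T n)) (fun n => aut_inv (T n))) => // n.
  exact: aut_funK.
have gK : \forall x \ae P, f (g x) = x.
  apply: (inv (fun n => aut_inv (T n)) (fun n => aut_fun (T n))) => // n.
  exact: aut_invK.
exists (Automorphism mf mg pf fK gK).
apply: (dcauchy_sub_dcvg aut_dist_pseudo nk uc).
by apply: cvg0D; apply: (wdist_cvg HD).
Qed.

End automorphism_distance.

(** * Continuity of measurable flows *)

Section steinhaus.
Context {R : realType}.
Let mu : {measure set (measurableTypeR R) -> \bar R} := @lebesgue_measure R.

Lemma real_pseudo_dist : pseudo_dist (fun x y : R => `|x - y|).
Proof.
split=> [x|x y|y x w]; [by rewrite subrr normr0|exact: distrC|exact: ler_distD].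
Qed.

Lemma real_dopenP (U : set R) : dopen (fun x y : R => `|x - y|) U <-> open U.
Proof.
rewrite openE; split=> [oU x /oU[e e0 H]|oU x /oU].
  by apply/nbhs_ballP; exists e.
by move=> /nbhs_ballP[e /= e0 H]; exists e.
Qed.

Lemma lebesgue_measure_shift (h : R) (A : set R) : measurable A ->
  mu ((fun x => x + h) @^-1` A) = mu A.
Proof.
move=> mA; pose f (x : measurableTypeR R) : measurableTypeR R := x + h.
have mf : measurable_fun setT f.
  by apply: measurable_funD => //; exact: measurable_cst.
pose nu := measure_function_pushforward__canonical__measure_function_Measure mu mf.
have H : forall B, ocitv B -> lebesgue_measure B = nu B.
  move=> B /ocitvP[->|[[a b] /= ab ->]]; first by rewrite !measure0.
  have fE : f @^-1` `]a, b]%classic = `](a - h), (b - h)]%classic.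
    by apply/seteqP; split=> x /=; rewrite /f !in_itv/= ltrBlDr lerBrDr.
  rewrite -[nu _]/(mu (f @^-1` `]a, b]%classic)) fE.
  rewrite /mu lebesgue_measure_itv [RHS]lebesgue_measure_itv/= !lte_fin ltrD2r ab.
  rewrite -!EFinB.
  by congr EFin; ring.
by rewrite [RHS](lebesgue_measure_unique H).
Qed.

(** More than half of [E] keeps a distance [2^-1 ^+ n] from the complement of an open [U] that
    exceeds [E] by less than half the measure of [E]. If no [x] and [x + h] were both in [E],
    translation by [h] would move that part into the difference of [U] and [E], which is too
    small. *)
Theorem steinhaus (E : set R) : measurable E -> (0 < mu E)%E ->
  exists2 c, 0 < c & forall h, `|h| < c -> exists2 x, E x & E (x + h).
Proof.
wlog Efin : E / (mu E < +oo)%E.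
  move=> WL mE E0; pose F n := E `&` `[(- n%:R)%R, n%:R]%classic.
  have mF n : measurable (F n) by apply: measurableI.
  have [n Fn] : exists n, (0 < mu (F n))%E.
    apply: contrapT => /forallNP nF.
    suff E00 : mu E = 0%E by rewrite E00 ltxx in E0.
    have EF : E = \bigcup_n F n.
      apply/seteqP; split=> [x Ex|x [n _ []]//].
      exists (Num.bound `|x|) => //; split => //=; rewrite in_itv/=.
      by rewrite -ler_norml ltW// archi_boundP.
    apply/(@negligibleP _ _ _ mu _ mE); rewrite EF; apply: negligible_bigcup => k.
    apply/(@negligibleP _ _ _ mu _ (mF k))/eqP; rewrite eq_le measure_ge0 andbT leNgt.
    exact/negP/nF.
  have [|c c0 H] := WL (F n) _ (mF n) Fn.
    rewrite (@le_lt_trans _ _ (mu `[(- n%:R)%R, n%:R]%classic))//.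
      by rewrite le_measure ?inE//; [exact: mF|exact: subIsetr].
    rewrite [ltLHS](lebesgue_measure_itv `[(- n%:R)%R, n%:R])/=.
    by case: ifP => _; rewrite ?ltry// -EFinB ltry.
  by exists c => // h /H[x [Ex _] [Exh _]]; exists x.
move=> mE E0.
have muE : mu E = (fine (mu E))%:E by rewrite fineK// ge0_fin_numE.
pose e := fine (mu E) / 2.
have e0 : 0 < e by rewrite divr_gt0// -lte_fin -muE.
have [U [/real_dopenP oU EU UdE]] := lebesgue_regularity_outer mE Efin e0.
have pR := real_pseudo_dist.
pose F n := E `&` shrinking (fun x y : R => `|x - y|) U n.
have mF n : measurable (F n).
  apply: measurableI => //; rewrite -[X in measurable X]setCK; apply: measurableC.
  by apply: open_measurable; apply/real_dopenP; exact: dopen_shrinkingC.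
have EF : \bigcup_n F n = E.
  by rewrite -setI_bigcupr (bigcup_shrinking pR oU); exact/setIidl.
have [n Fn] : exists n, (e%:E < mu (F n))%E.
  apply: contrapT => /forallNP nF.
  have : (mu E <= e%:E)%E.
    have cF : mu \o F @ \oo --> mu E.
      rewrite -EF; apply: nondecreasing_cvg_mu => //; first by rewrite EF.
      by move=> i j ij; apply/subsetPset; apply: setIS; exact: shrinking_homo.
    rewrite -(cvg_lim _ cF)//; apply: lime_le; first by apply/cvg_ex; exists (mu E).
    by apply: nearW => n; rewrite leNgt; exact/negP/nF.
  by rewrite muE lee_fin /e leNgt gtr_pMr ?invf_lt1 ?ltr1n// -lte_fin -muE.
exists (2^-1 ^+ n); first exact: exprhalf_gt0.
move=> h hn; apply: contrapT => nh.
have : (mu (F n) <= mu (U `\` E))%E.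
  rewrite -(lebesgue_measure_shift (- h) (mF n)) le_measure// ?inE.
  - rewrite -[X in measurable X]setTI.
    have : measurable_fun setT (fun x : R => x + - h).
      by apply: measurable_funD => //; exact: measurable_cst.
    by apply.
  - by apply: measurableD => //; apply: open_measurable; exact/real_dopenP.
  - move=> x [Ex Ux]; split.
      by apply: Ux; rewrite addrAC subrr add0r normrN.
    by move=> Ex'; apply: nh; exists (x - h) => //; rewrite subrK.
by rewrite leNgt (lt_trans UdE Fn).
Qed.

End steinhaus.

Section flow_continuity.
Context {d : measure_display} {X : measurableType d} {R : realType}.
Variables (P : probability X R) (D : X -> X -> R) (z : nat -> X).
Hypothesis HD : polish_dist D z.
Variable T : flow P.

(* The times [t] at which [T_t^-1 A] is close to a given member of a countable
   dense family have positive measure for some member, so that Steinhaus' theorem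
   applies to them. *)
Lemma flow_continuous A e : measurable A -> 0 < e ->
  exists2 c, 0 < c & forall s t, `|s - t| < c -> adist P A (T s) (T t) < e.
Proof.
move=> mA e0; have e2 : 0 < e / 2 by rewrite divr_gt0.
have mT t : measurable (T t @^-1` A) by exact: preimage_measurable (measurable_flow_at T t) mA.
have mb := measurable_base_set HD.
(* [Y i] collects the symmetric differences for all times, so that their probability depends
   measurably on [t], as the measure of the sections of a measurable set. *)
pose Y i : set (R * X) := ((fun w => T w.1 w.2) @^-1` A) `+` (snd @^-1` base_set D z i).
have mY i : measurable (Y i).
  apply: measurable_setY; rewrite -[X in measurable X]setTI.
    exact: measurable_flow.
  exact: measurable_snd.
pose F i := [set t | sd P (T t @^-1` A) (base_set D z i) < e / 2].
have YE i t : xsection (Y i) t = (T t @^-1` A) `+` base_set D z i.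
  by apply/seteqP; split=> x; rewrite /xsection /= inE.
have mF i : measurable (F i).
  have -> : F i = (P \o xsection (Y i)) @^-1` [set` `]-oo, (e / 2)%:E[ ].
    apply/seteqP; split=> t; rewrite /F /= in_itv/= YE prE ?lte_fin//;
    exact: measurable_setY.
  rewrite -[X in measurable X]setTI; apply: (measurable_fun_xsection P (mY i)) => //.
  exact: emeasurable_itv.
have [i Fi] : exists i, (0 < (@lebesgue_measure R) (F i))%E.
  apply: contrapT => /forallNP nF.
  have FT : \bigcup_i F i = setT.
    apply/seteqP; split=> // t _; have [i Hi] := base_dense P HD (mT t) e2.
    by exists i.
  have : (@lebesgue_measure R).-negligible [set: R].
    rewrite -FT; apply: negligible_bigcup => k.
    apply/(@negligibleP _ _ _ (@lebesgue_measure R) _ (mF k))/eqP.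
    by rewrite eq_le measure_ge0 andbT leNgt; exact/negP/nF.
  move=> /(@negligibleP _ _ _ (@lebesgue_measure R) _ measurableT).
  have := @lebesgue_measure_itv R `]-oo, +oo[; rewrite set_itvNyy/= => T0.
  by move/(etrans (esym T0)).
have [c c0 Hc] := steinhaus (mF i) Fi.
exists c => // s t st; have [r Fr Frst] := Hc _ st.
(* [T u] preserves [P], so the distance depends on the difference of the times only. *)
have shift a b u : adist P A (T (u + a)) (T (u + b)) = adist P A (T a) (T b).
  rewrite addrC [u + b]addrC.
  have TE v : T (v + u) = T v \o T u by apply/funext => x; rewrite /= flowD.
  rewrite !TE adist_compr//; try exact: measurable_flow_at.
  exact: flow_preserves.
have -> : adist P A (T s) (T t) = adist P A (T (r + (s - t))) (T r).
  rewrite -(shift s t (r - t)) addrAC -addrA; congr (adist P A (T _) (T _)); ring.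
have := sd_tri P (mT (r + (s - t))) (mb i) (mT r).
move: Fr Frst; rewrite /F /= /adist [X in _ -> _ -> _ <= _ + X -> _]sd_sym; lra.
Qed.

End flow_continuity.

(** * Borel sets of scalings and times *)

Section nonzero_reals.
Context {R : realType}.
Implicit Types s u : Rstar R.

(** The term of the inverses keeps Cauchy sequences away from 0, which makes [Rstar] complete, and
    it makes inversion isometric. *)
Definition rdist s u : R := `|val s - val u| + `|(val s)^-1 - (val u)^-1|.

Lemma rdist_pseudo : pseudo_dist rdist.
Proof.
split=> [s|s u|u s v].
- by rewrite /rdist !subrr normr0 addr0.
- by rewrite /rdist distrC [X in _ + X]distrC.
- by rewrite /rdist addrACA lerD// ler_distD.
Qed.

Lemma rdist_eq0 s u : rdist s u = 0 -> s = u.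
Proof.
move=> su; apply: val_inj; apply/eqP; rewrite -subr_eq0 -normr_le0.
by apply: (@le_trans _ _ (rdist s u)); [rewrite lerDl|rewrite su].
Qed.

Lemma ler_rdist s u : `|val s - val u| <= rdist s u.
Proof. by rewrite lerDl. Qed.

Lemma rdist_small_codes : small_codes rdist.
Proof.
apply: small_codesD.
  exact: (small_codes_comp (fun s : Rstar R => val s) small_codes_real).
exact: (small_codes_comp (fun s : Rstar R => (val s)^-1) small_codes_real).
Qed.

Lemma real_dcvgP (u : R^nat) (l : R) :
  dcvg (fun x y : R => `|x - y|) u l <-> u @ \oo --> l.
Proof.
split=> [/(dcvgP real_pseudo_dist) ul|ul].
  apply/cvgrPdist_lt => e e0; have [N H] := ul e e0.
  by exists N => // n Nn; rewrite /= distrC; exact: H.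
apply/(dcvgP real_pseudo_dist) => e e0.
have [N _ H] := (cvgrPdist_lt _ _).1 ul e e0; exists N => n Nn.
by rewrite distrC; exact: H.
Qed.

Lemma real_dcomplete : dcomplete (fun x y : R => `|x - y|).
Proof.
move=> u uc; have : cauchy (u @ \oo).
  apply/cauchyP => e e0; have [N H] := uc e e0; exists (u N).
  by exists N => // n Nn; apply: H.
move=> /cauchy_cvg/cvg_ex[l ul]; exists l; exact/real_dcvgP.
Qed.

Lemma rdist_complete : dcomplete rdist.
Proof.
move=> u uc.
have [l ul] : exists l, dcvg (fun x y : R => `|x - y|) (fun n => val (u n)) l.
  apply: real_dcomplete => e /uc[N H]; exists N => m n Nm Nn.
  by rewrite (le_lt_trans _ (H m n Nm Nn))// lerDl.
have [r ur] : exists r, dcvg (fun x y : R => `|x - y|) (fun n => (val (u n))^-1) r.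
  apply: real_dcomplete => e /uc[N H]; exists N => m n Nm Nn.
  by rewrite (le_lt_trans _ (H m n Nm Nn))// lerDr.
have cl : val (u n) @[n --> \oo] --> l by exact/real_dcvgP.
have cr : (val (u n))^-1 @[n --> \oo] --> r by exact/real_dcvgP.
have lr : l * r = 1.
  have : 1 @[_ --> \oo] --> l * r.
    rewrite (_ : (fun _ => 1) = (fun n => val (u n) * (val (u n))^-1)); first exact: cvgM.
    by apply/funext => n; rewrite divff// Rstar_neq0.
  by move=> /cvg_unique; apply => //; exact: cvg_cst.
have l0 : l != 0 by apply/eqP => l0; move: lr; rewrite l0 mul0r => /eqP; rewrite eq_sym oner_eq0.
exists (mkRstar l0); rewrite /dcvg /rdist /=.
have -> : l^-1 = r by rewrite -[RHS]mul1r -(mulVf l0) -mulrA lr mulr1.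
exact: cvg0D.
Qed.

Lemma measurable_borel_Rstar (B : set R) : measurable B ->
  borel (Rstar R) [set s | B (val s)].
Proof.
move=> mB; pose Q := [set B : set R | borel (Rstar R) [set s | B (val s)]].
have SQ : sigma_algebra setT Q.
  have [S0 SC SU] := smallest_sigma_algebra setT (@open (Rstar R)).
  split; first exact: S0.
    move=> A QA; have := SC [set s : Rstar R | A (val s)] QA.
    by rewrite !setTD; apply.
  by move=> F QF; exact: (SU (fun n => [set s : Rstar R | F n (val s)]) QF).
have : (RGenOpens.G (R := R)).-sigma.-measurable B.
  by rewrite -RGenOpens.measurableE; exact: mB.
move=> /(_ Q); apply.
split=> // _ [x [y ->]]; apply: sub_sigma_algebra.
apply: (@open_comp _ _ (fun s : Rstar R => val s)); last exact: interval_open.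
by move=> s _; exact: initial_continuous.
Qed.

End nonzero_reals.

(** * Lifts of scalings and times to automorphisms *)

Section lifts.
Context {d : measure_display} {X : measurableType d} {R : realType}.
Variables (P : probability X R) (T : flow P).
Implicit Types (S U : automorphism P) (s u : Rstar R) (J : set R).

Lemma conjugates_intertwines S (f g : X -> X) :
  conjugates S f g <-> \forall x \ae P, S (f x) = g (S x).
Proof.
split=> H.
  have HS := ae_preserves (measurable_aut S) (@aut_preserves _ _ _ _ S) H.
  have K : \forall x \ae P, aut_inv S (S x) = x := aut_funK S.
  by apply: filterS2 HS K => x /= <- ->.
have HS := ae_preserves (measurable_aut_inv S) (@aut_inv_preserves _ _ _ _ S) H.
by apply: filterS2 HS (aut_invK S) => x /= -> ->.
Qed.

(* The automorphisms conjugating [T_t] to [T_(st)], for all [t] in [J]; for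
   [J = R] they witness [s \in I(T)], for [J = {1}] they witness [s \in E(T)]. *)
Definition lift J s S := forall t, J t -> conjugates S (T t) (T (val s * t)).

(** As a quotient of two lifts of [s], [S^-1 U] commutes with [T t] for [t] in [J]. No group law on
    the scalings is involved, so this covers E(T) too. *)
Lemma lift_transport J s s' S U S' : lift J s S -> lift J s U -> lift J s' S' ->
  lift J s' (aut_comp S' (aut_comp (aut_sym S) U)).
Proof.
move=> Ss Us Ss' t Jt; apply: conjugates_trans (Ss' t Jt).
apply: conjugates_trans (Us t Jt) _; apply: conjugates_sym (Ss t Jt).
  exact: measurable_flow_at.
exact: flow_preserves.
Qed.

Lemma lift1 J : lift J 1%g (aut_id P).
Proof. by move=> t _; apply: aeW => x /=; rewrite mul1r. Qed.

Lemma lift_mul s u S U : lift setT s S -> lift setT u U ->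
  lift setT (s * u)%g (aut_comp S U).
Proof.
move=> Ss Uu t _; apply: conjugates_trans (Uu t I) _.
by rewrite /= -mulrA; exact: Ss.
Qed.

Lemma lift_inv s S : lift setT s S -> lift setT s^-1%g (aut_sym S).
Proof.
move=> Ss t _; apply: conjugates_sym.
- exact: measurable_flow_at.
- exact: flow_preserves.
- by have := Ss (val (s^-1)%g * t) I; rewrite /= mulrA divff ?mul1r// Rstar_neq0.
Qed.

Lemma iso_scalings_lift s : iso_scalings T s <-> exists S, lift setT s S.
Proof.
split=> [[S Ss]|[S Ss]].
  exists (aut_sym S) => t _; apply: conjugates_sym (Ss t).
    exact: measurable_flow_at.
  exact: flow_preserves.
by apply: flow_isomorphic_sym; exists S => t; exact: Ss.
Qed.

Lemma iso_times_lift s : iso_times T s <-> exists S, lift [set 1] s S.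
Proof.
split=> [[S Ss]|[S Ss]]; exists S; first by move=> t ->; rewrite mulr1.
by rewrite -[val s]mulr1; exact: Ss.
Qed.

Variables (D : X -> X -> R) (z : nat -> X).
Hypothesis HD : polish_dist D z.
Notation wd := (wdist P D z).
Notation adst := (aut_dist D z).

Let mA S := measurable_aut S.
Let mI S := measurable_aut_inv S.
Let pA S := @aut_preserves _ _ _ _ S.
Let pI S := @aut_inv_preserves _ _ _ _ S.
Let mT t := measurable_flow_at T t.

Lemma aut_dcvg_adist (S : nat -> automorphism P) U A e : dcvg adst S U ->
  measurable A -> 0 < e ->
  exists N, forall n, (N <= n)%N -> adist P A (S n) U < e.
Proof.
move=> /(dcvgP (aut_dist_pseudo P HD)) SU mE e0.
have [c c0 Hc] := adist_continuous P HD mE e0.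
have [N HN] := SU c c0; exists N => n /HN Sn; apply: Hc => //.
exact: le_lt_trans (wdist_le_aut HD _ _) Sn.
Qed.

(** On base sets, [U \o T t] is close to [S n \o T t], which equals [T (s n * t) \o S n] almost
    everywhere; this is close to [T (u * t) \o S n] by continuity of the flow, and that to
    [T (u * t) \o U]. *)
Lemma lift_closed J (s : nat -> Rstar R) (S : nat -> automorphism P) u U :
  dcvg (@rdist R) s u -> dcvg adst S U -> (forall n, lift J (s n) (S n)) ->
  lift J u U.
Proof.
move=> su SU Ss t Jt; apply/conjugates_intertwines.
have mUT := measurableT_comp (mA U) (mT t).
have mTU := measurableT_comp (mT (val u * t)) (mA U).
apply: (ae_eq_base HD mUT mTU) => k.
have mk := measurable_base_set HD k.
apply/eqP; rewrite eq_le adist_ge0 andbT; apply/ler_addgt0Pr => e e0.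
rewrite add0r; have e3 : 0 < e / 3 by rewrite divr_gt0.
have [N1 H1] := aut_dcvg_adist SU mk e3.
have [N2 H2] := aut_dcvg_adist SU (preimage_measurable (mT (val u * t)) mk) e3.
have [c c0 Hc] := flow_continuous HD T mk e3.
(* Adding 1 covers [t = 0]. *)
have t1 : 0 < `|t| + 1 by rewrite ltr_wpDl.
have [N3 H3] := (dcvgP (@rdist_pseudo R) _ _).1 su _ (divr_gt0 c0 t1).
pose n := maxn N1 (maxn N2 N3).
have mSnT := measurableT_comp (mA (S n)) (mT t).
have mTSn r := measurableT_comp (mT r) (mA (S n)).
have h1 : adist P (base_set D z k) (U \o T t) (S n \o T t) < e / 3.
  rewrite adistC adist_compr//; last exact: flow_preserves.
  by apply: H1; rewrite leq_maxl.
have h2 : adist P (base_set D z k) (S n \o T t) (T (val (s n) * t) \o S n) = 0.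
  by apply: adist_ae => //; apply/conjugates_intertwines; exact: Ss.
have h3 : adist P (base_set D z k) (T (val (s n) * t) \o S n) (T (val u * t) \o S n) < e / 3.
  rewrite adist_compr//; apply: Hc; rewrite -mulrBl normrM.
  have := le_lt_trans (ler_rdist _ _) (H3 n (leq_trans (leq_maxr N2 N3) (leq_maxr _ _))).
  rewrite ltr_pdivlMr// => /(le_lt_trans _); apply.
  by rewrite ler_wpM2l// lerDl.
have h4 : adist P (base_set D z k) (T (val u * t) \o S n) (T (val u * t) \o U) < e / 3.
  by apply: H2; rewrite (leq_trans (leq_maxl N2 N3))// leq_maxr.
have := adist_tri P mUT mSnT mTU mk.
have := adist_tri P mSnT (mTSn (val (s n) * t)) mTU mk.
have := adist_tri P (mTSn (val (s n) * t)) (mTSn (val u * t)) mTU mk.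
lra.
Qed.

Section graph.
Variable J : set R.

Definition lift_graph := {p : Rstar R * automorphism P | lift J p.1 p.2}.

Definition lift_dist (p q : lift_graph) :=
  rdist (sval p).1 (sval q).1 + adst (sval p).2 (sval q).2.

Lemma lift_dist_pseudo : pseudo_dist lift_dist.
Proof.
have pR := @rdist_pseudo R; have pG := aut_dist_pseudo P HD.
split=> [p|p q|q p r]; rewrite /lift_dist.
- by rewrite (pdistxx pR) (pdistxx pG) addr0.
- by rewrite (pdistC pR) (pdistC pG).
- by rewrite [leRHS]addrACA lerD//; [exact: (pdist_tri pR)|exact: (pdist_tri pG)].
Qed.

Lemma lift_dist_small_codes : small_codes lift_dist.
Proof.
apply: small_codesD.
  exact: (small_codes_comp (fun p : lift_graph => (sval p).1) (@rdist_small_codes R)).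
exact: (small_codes_comp (fun p : lift_graph => (sval p).2) (aut_dist_small_codes P HD)).
Qed.

Lemma lift_dist_complete : dcomplete lift_dist.
Proof.
have pR := @rdist_pseudo R; have pG := aut_dist_pseudo P HD.
move=> p pc.
have [s ps] : exists s, dcvg (@rdist R) (fun n => (sval (p n)).1) s.
  apply: rdist_complete => e /pc[N H]; exists N => m n Nm Nn.
  by rewrite (le_lt_trans _ (H m n Nm Nn))// /lift_dist lerDl (pdist_ge0 pG).
have [S pS] : exists S, dcvg adst (fun n => (sval (p n)).2) S.
  apply: (aut_dist_complete HD) => e /pc[N H]; exists N => m n Nm Nn.
  by rewrite (le_lt_trans _ (H m n Nm Nn))// /lift_dist lerDr (pdist_ge0 pR).
have sS := lift_closed ps pS (fun n => svalP (p n)).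
exists (exist _ (s, S) sS); exact: cvg0D.
Qed.

(* Over a fixed [s] the lifts form a coset of the centralizer, so that any lift of
   [s'] close to [S] is carried to one close to [U] by right translation. *)
Lemma lift_saturation_open (V : set lift_graph) : dopen lift_dist V ->
  dopen lift_dist [set p | exists2 q, V q & (sval q).1 = (sval p).1].
Proof.
move=> oV [[s S] sS] [[[s_ U] sU] VU /= ss]; subst s_.
have [e e0 He] := oV _ VU; have e3 : 0 < e / 3 by rewrite divr_gt0.
(* The inverse of the new lift [W] below is [h] composed with the inverse of [S']: a left
   composition with a fixed map, whence the modulus [c]. [W] itself is a right translate of [S'], so
   its [wdist] to [U] is that of [S'] to [S]. *)
pose h := aut_comp (aut_sym U) S.
have [c c0 Hc] := wdist_compl_continuous P HD (measurable_aut h) e3.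
exists (Num.min (e / 3) c); first by rewrite lt_min e3.
move=> [[s' S'] sS']; rewrite lt_min /lift_dist /= => /andP[se sc].
have sS'' : lift J s' (aut_comp S' (aut_comp (aut_sym S) U)).
  exact: lift_transport sS sU sS'.
exists (exist _ (s', _) sS'') => //; apply: He; rewrite /lift_dist /=.
have r0 := pdist_ge0 (@rdist_pseudo R) s s'.
have a0 := pdist_ge0 (aut_dist_pseudo P HD) S S'.
have w1 := wdist_le_aut HD S S'.
have w2 : wd (aut_inv S) (aut_inv S') <= adst S S'.
  by rewrite -aut_dist_inv; exact: (wdist_le_aut HD (aut_sym S) (aut_sym S')).
set W := aut_comp S' _.
have W1 : wd U W = wd S S'.
  pose k := aut_comp (aut_sym S) U.
  rewrite -(wdist_compr HD (mA S) (mA S') (mA k) (@pA k)).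
  apply: (wdist_ae HD (mA U) (mA W) (measurableT_comp (mA S) (mA k))
    (measurableT_comp (mA S') (mA k))); last exact: aeW.
  have := ae_preserves (mA U) (@pA U) (aut_invK S).
  by apply: filterS => x /= ->.
have W2 : wd (aut_inv U) (aut_inv W) < e / 3.
  have H : wd (h \o aut_inv S) (h \o aut_inv S') < e / 3.
    by apply: Hc; [exact: mI|exact: mI|exact: pI|exact: pI|lra].
  rewrite (le_lt_trans _ H)// le_eqVlt; apply/orP; left; apply/eqP.
  apply: (wdist_ae HD (mI U) (mI W) (measurableT_comp (mA h) (mI S))
    (measurableT_comp (mA h) (mI S'))); last exact: aeW.
  by apply: filterS (aut_invK S) => x /= ->.
rewrite /aut_dist W1; lra.
Qed.

Lemma lift_borel : borel (Rstar R) [set s | exists S, lift J s S].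
Proof.
(* [measurable_range] wants a dense sequence, which an empty graph does not have. *)
have [[s0 [S0 sS0]]|no] := pselect (exists s S, lift J s S); last first.
  rewrite (_ : [set s | _] = set0).
    by have [] := smallest_sigma_algebra setT (@open (Rstar R)).
  by apply/seteqP; split=> // s [S sS]; case: no; exists s, S.
have [w dw] := small_codes_ddense (exist _ (s0, S0) sS0 : lift_graph) lift_dist_small_codes.
pose f (p : lift_graph) : R := val (sval p).1.
rewrite (_ : [set s | _] = [set s | range f (val s)]); last first.
  apply/seteqP; split=> [s [S sS]|s [[[u U] uU] _ /= /val_inj us]].
    by exists (exist _ (s, S) sS).
  by exists U; rewrite -us.
apply: measurable_borel_Rstar.
apply: (measurable_range lift_dist_pseudo lift_dist_complete dw) => [p e e0|V oV].
  exists e => // q; apply: le_lt_trans; apply: le_trans (ler_rdist _ _) _.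
  by rewrite /lift_dist lerDl (pdist_ge0 (aut_dist_pseudo P HD)).
rewrite (_ : f @^-1` _ = [set p | exists2 q, V q & (sval q).1 = (sval p).1]).
  exact: lift_saturation_open.
apply/seteqP; split=> p [q Vq qp]; exists q => //; first exact: val_inj.
by rewrite /f qp.
Qed.

End graph.

End lifts.

(** * The Polish topology on I(T) *)

Lemma Rstar_mulgC (R : realType) (s u : Rstar R) : (s * u)%g = (u * s)%g.
Proof. by apply: val_inj; rewrite /= mulrC. Qed.

Section scaling_metric.
Context {d : measure_display} {X : measurableType d} {R : realType}.
Variables (P : probability X R) (T : flow P).
Variables (D : X -> X -> R) (z : nat -> X).
Hypothesis HD : polish_dist D z.
Implicit Types (S U a b c : automorphism P) (s u : Rstar R).
Notation wd := (wdist P D z).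
Notation adst := (aut_dist D z).
Notation lift := (lift T setT).
Notation I := (iso_scalings T).

Let mA S := measurable_aut S.
Let mI S := measurable_aut_inv S.
Let pA S := @aut_preserves _ _ _ _ S.
Let pI S := @aut_inv_preserves _ _ _ _ S.
Let pG := aut_dist_pseudo P HD.

(** The distance of the identity to the coset of the lifts of [s], that is, the quotient norm coming
    from [wdist]. It has a meaning for [s] in I(T) only, the set being empty otherwise. *)
Definition lift_norm s : R := inf [set wd S id | S in lift s].

Lemma wdist_id_div a b : wd (a \o aut_inv b) id = wd a b.
Proof.
rewrite -(wdist_compr HD (mA a) (mA b) (mI b) (@pI b)).
apply: (wdist_ae HD (measurableT_comp (mA a) (mI b)) (@measurable_id _ _ setT)
  (measurableT_comp (mA a) (mI b)) (measurableT_comp (mA b) (mI b))).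
  exact: aeW.
by apply: filterS (aut_invK b) => x /= ->.
Qed.

Lemma wdist_id_inv c : wd (aut_inv c) id = wd c id.
Proof. by rewrite [RHS]wdistC; exact: (wdist_id_div (aut_id P) c). Qed.

Lemma wdist_id_comp a b : wd (a \o b) id <= wd a id + wd b id.
Proof.
have mid := @measurable_id _ X setT.
apply: (le_trans (wdist_tri P HD (measurableT_comp (mA a) (mA b)) (mA b) mid)).
by rewrite lerD2r -(wdist_compr HD (mA a) mid (mA b) (@pA b)).
Qed.

Lemma lift_norm_le s S : lift s S -> lift_norm s <= wd S id.
Proof.
move=> sS; apply: ge_inf; last by exists S.
exists 0 => _ [U _ <-]; exact: (wdist_ge0 P HD (mA U) (@measurable_id _ _ setT)).
Qed.

Lemma lift_norm_lt s e : I s -> lift_norm s < e ->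
  exists2 S, lift s S & wd S id < e.
Proof.
move=> /iso_scalings_lift[S0 sS0] se.
have [|_ [S sS <-] Se] := @inf_lt _ [set wd S id | S in lift s] e _ se.
  by exists (wd S0 id), S0.
by exists S.
Qed.

Lemma lift_norm_ge0 s : I s -> 0 <= lift_norm s.
Proof.
move=> /iso_scalings_lift[S0 sS0]; apply: lb_le_inf.
  by exists (wd S0 id), S0.
by move=> _ [U _ <-]; exact: (wdist_ge0 P HD (mA U) (@measurable_id _ _ setT)).
Qed.

Lemma lift_norm1 : lift_norm 1%g = 0.
Proof.
have I1 : I 1%g by apply/iso_scalings_lift; exists (aut_id P); exact: lift1.
apply/eqP; rewrite eq_le (lift_norm_ge0 I1) andbT.
apply: (le_trans (lift_norm_le (lift1 T (J := setT)))).
by rewrite (wdist_ae0 HD (mA (aut_id P)) (@measurable_id _ _ setT))//; exact: aeW.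
Qed.

Lemma lift_normV_le s : I s -> lift_norm s^-1%g <= lift_norm s.
Proof.
move=> Is; apply/ler_addgt0Pr => e e0.
have [S sS Se] : exists2 S, lift s S & wd S id < lift_norm s + e.
  by apply: lift_norm_lt => //; rewrite ltrDl.
by rewrite (le_trans (lift_norm_le (lift_inv sS)))//= wdist_id_inv ltW.
Qed.

Lemma lift_normV s : I s -> lift_norm s^-1%g = lift_norm s.
Proof.
move=> Is; apply/eqP; rewrite eq_le lift_normV_le//= -[in leLHS](invgK s).
apply: lift_normV_le; have [S sS] := (iso_scalings_lift T s).1 Is.
by apply/iso_scalings_lift; exists (aut_sym S); exact: lift_inv.
Qed.

Lemma lift_normM s u : I s -> I u -> lift_norm (s * u)%g <= lift_norm s + lift_norm u.
Proof.
move=> Is Iu; apply/ler_addgt0Pr => e e0; have e2 : 0 < e / 2 by rewrite divr_gt0.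
have [S sS Se] : exists2 S, lift s S & wd S id < lift_norm s + e / 2.
  by apply: lift_norm_lt => //; rewrite ltrDl.
have [U uU Ue] : exists2 U, lift u U & wd U id < lift_norm u + e / 2.
  by apply: lift_norm_lt => //; rewrite ltrDl.
apply: (le_trans (lift_norm_le (lift_mul sS uU))).
apply: (le_trans (wdist_id_comp S U)); lra.
Qed.

Implicit Types x y w : scaling_group T.

Lemma scaling_iso x : I (val x).
Proof. exact: set_valP. Qed.

Lemma scaling_div_iso x y : I (val x * (val y)^-1)%g.
Proof. exact: (scaling_iso (x * y^-1)%g). Qed.

(* As [I(T)] is abelian, its quotient metric is translation invariant. *)
Definition scaling_dist x y :=
  lift_norm (val x * (val y)^-1)%g + rdist (val x) (val y).

Lemma scaling_dist_pseudo : pseudo_dist scaling_dist.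
Proof.
have pR := @rdist_pseudo R.
split=> [x|x y|y x w]; rewrite /scaling_dist.
- by rewrite mulgV lift_norm1 (pdistxx pR) addr0.
- rewrite (pdistC pR) -(invgF (val y)) lift_normV//; exact: scaling_div_iso.
- rewrite [leRHS]addrACA lerD//; last exact: (pdist_tri pR).
  rewrite (_ : (val x * _)%g = (val x * (val y)^-1) * (val y * (val w)^-1))%g.
    by apply: lift_normM; exact: scaling_div_iso.
  by rewrite mulgA mulgVK.
Qed.

(** [A n] is first replaced by [a], through right invariance; then [aut_inv (B n)] by [aut_inv b],
    under the fixed map [a]. *)
Lemma aut_comp_inv_cvg (A B : nat -> automorphism P) a b :
  dcvg adst A a -> dcvg adst B b ->
  (fun n => wd (A n \o aut_inv (B n)) (a \o aut_inv b)) @ \oo --> (0 : R).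
Proof.
move=> Aa Bb; apply/cvg0P.
  by move=> n; apply: (wdist_ge0 P HD); exact: measurableT_comp.
move=> e e0; have e2 : 0 < e / 2 by rewrite divr_gt0.
have [c c0 Hc] := wdist_compl_continuous P HD (mA a) e2.
have [N1 H1] := (dcvgP pG _ _).1 Aa _ e2.
have [N2 H2] := (dcvgP pG _ _).1 Bb _ c0.
exists (maxn N1 N2) => n; rewrite geq_max => /andP[/H1 h1 /H2 h2].
have mAB := measurableT_comp (mA (A n)) (mI (B n)).
have maB := measurableT_comp (mA a) (mI (B n)).
apply: (le_lt_trans (wdist_tri P HD mAB maB (measurableT_comp (mA a) (mI b)))).
rewrite [e]splitr ltrD//.
  rewrite (wdist_compr HD (mA (A n)) (mA a) (mI (B n)) (@pI (B n))).
  exact: le_lt_trans (wdist_le_aut HD _ _) h1.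
apply: Hc; [exact: mI|exact: mI|exact: pI|exact: pI|].
apply: le_lt_trans h2; rewrite -aut_dist_inv.
exact: (wdist_le_aut HD (aut_sym (B n)) (aut_sym b)).
Qed.

Lemma aut_div_dcvg (A B : nat -> automorphism P) a b :
  dcvg adst A a -> dcvg adst B b ->
  dcvg adst (fun n => aut_comp (A n) (aut_sym (B n))) (aut_comp a (aut_sym b)).
Proof.
by move=> Aa Bb; apply: cvg0D; exact: aut_comp_inv_cvg.
Qed.

(** * Completeness of the quotient distance *)

Section completeness.
Variable y : nat -> scaling_group T.
Hypothesis yc : dcauchy scaling_dist y.

(* How large [n] and [m] must be depends on [b]: this is why the proof of
   completeness uses two sequences of automorphisms, each of which is modified
   while the other is kept. *)
Lemma small_lift b e : 0 < e -> exists N, forall n m, (N <= n)%N -> (N <= m)%N ->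
  exists2 c, lift (val (y n) * (val (y m))^-1)%g c & adst (aut_comp c b) b < e.
Proof.
move=> e0; have e2 : 0 < e / 2 by rewrite divr_gt0.
have [r r0 Hr] := wdist_compl_continuous P HD (mI b) e2.
have m0 : 0 < Num.min (e / 2) r by rewrite lt_min e2.
have [N HN] := yc m0; exists N => n m Nn Nm.
have /(lift_norm_lt (scaling_div_iso _ _))[c yc' ce] :
    lift_norm (val (y n) * (val (y m))^-1)%g < Num.min (e / 2) r.
  by apply: le_lt_trans (HN n m Nn Nm); rewrite lerDl (pdist_ge0 (@rdist_pseudo R)).
exists c => //; rewrite /aut_dist [e]splitr ltrD//.
  have -> : wd (aut_comp c b) b = wd c id.
    exact: (wdist_compr HD (mA c) (@measurable_id _ _ setT) (mA b) (@pA b)).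
  by rewrite (lt_le_trans ce)// ge_min lexx.
apply: (Hr (aut_inv c) id); [exact: mI|exact: measurable_id|exact: pI|by []|].
by rewrite wdist_id_inv (lt_le_trans ce)// ge_min lexx orbT.
Qed.

(** The last clause says that the index [p.1] is already large with respect to [p.2.2], the
    automorphism to be changed next. *)
Definition good j (p : nat * (automorphism P * automorphism P)) :=
  [/\ (j <= p.1)%N, lift (val (y p.1)) (aut_comp p.2.1 (aut_sym p.2.2)) &
    forall m, (p.1 <= m)%N ->
      exists2 c, lift (val (y p.1) * (val (y m))^-1)%g c &
                 adst (aut_comp c p.2.2) p.2.2 < 2^-1 ^+ j].

Lemma good_step j p : good j p -> exists q,
  [/\ good j.+1 q, adst q.2.1 p.2.1 < 2^-1 ^+ j & adst q.2.2 p.2.2 < 2^-1 ^+ j].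
Proof.
case: p => n [a b] [/= jn yab Hb].
(* [Na] is taken for the present [a], which is kept while [b] changes; thus [n1] is large with
   respect to both. *)
have [Na HNa] := small_lift a (exprhalf_gt0 j).
pose n1 := maxn n Na; have [c yc1 cb] := Hb n1 (leq_maxl _ _).
pose b' := aut_comp c b.
(* The automorphism is [(a b^-1) c^-1], a lift of [y n] times the inverse of [y n / y n1];
   commutativity simplifies this to [y n1]. *)
have yab' : lift (val (y n1)) (aut_comp a (aut_sym b')).
  have := lift_mul yab (lift_inv yc1).
  by rewrite invgF Rstar_mulgC mulgVK.
(* Before [a] is replaced by [c' a], the new index is made large with respect to [b'], as the last
   clause of [good j.+1] demands. *)
have [Nb HNb] := small_lift b' (exprhalf_gt0 j.+1).
pose n2 := maxn n1 (maxn Nb j.+1).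
have n12 : (n1 <= n2)%N by rewrite leq_maxl.
have [|c' yc2 ca] := HNa n2 n1 _ (leq_maxr _ _).
  by rewrite (leq_trans _ n12)// leq_maxr.
exists (n2, (aut_comp c' a, b')); split => //; split => /=.
- by rewrite !leq_max leqnn !orbT.
- have := lift_mul yc2 yab'.
  by rewrite mulgVK.
- move=> m n2m; apply: HNb; last first.
    by rewrite (leq_trans _ n2m)// leq_max leq_maxl orbT.
  by rewrite leq_max leq_maxl orbT.
Qed.

Lemma scaling_dist_cvg : exists l, dcvg scaling_dist y l.
Proof.
have [N0 HN0] := small_lift (aut_id P) (exprhalf_gt0 0).
have [S0 yS0] := (iso_scalings_lift T _).1 (scaling_iso (y N0)).
have good0 : good 0 (N0, (S0, aut_id P)).
  split => //= m Nm; exact: HN0.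
have [g Hg] : {g & forall jp : nat * (nat * (automorphism P * automorphism P)),
    good jp.1 jp.2 -> [/\ good jp.1.+1 (g jp), adst (g jp).2.1 jp.2.2.1 < 2^-1 ^+ jp.1 &
    adst (g jp).2.2 jp.2.2.2 < 2^-1 ^+ jp.1]}.
  apply: (@choice _ _ (fun jp q => good jp.1 jp.2 -> [/\ good jp.1.+1 q,
    adst q.2.1 jp.2.2.1 < 2^-1 ^+ jp.1 & adst q.2.2 jp.2.2.2 < 2^-1 ^+ jp.1])) => -[j p].
  have [/good_step[q Hq]|nh] := pselect (good j p); first by exists q.
  by exists p.
pose fix st j := if j is i.+1 then g (i, st i) else (N0, (S0, aut_id P)).
have gst j : good j (st j) by elim: j => [//|j IH]; have [] := Hg (j, st j) IH.
have [a sa] : exists a, dcvg adst (fun j => (st j).2.1) a.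
  apply: (aut_dist_complete HD); apply: (dcauchy_exprhalf pG (C := 1)) => j.
  rewrite mul1r (pdistC pG); apply/ltW.
  by have [] := Hg (j, st j) (gst j).
have [b sb] : exists b, dcvg adst (fun j => (st j).2.2) b.
  apply: (aut_dist_complete HD); apply: (dcauchy_exprhalf pG (C := 1)) => j.
  rewrite mul1r (pdistC pG); apply/ltW.
  by have [] := Hg (j, st j) (gst j).
pose k j := (st j).1; have kj j : (j <= k j)%N by have [] := gst j.
have [s ys] : exists s, dcvg (@rdist R) (fun n => val (y n)) s.
  apply: rdist_complete => e /yc[N H]; exists N => m n Nm Nn.
  rewrite (le_lt_trans _ (H m n Nm Nn))// lerDr.
  exact: (lift_norm_ge0 (scaling_div_iso _ _)).
have yks : dcvg (@rdist R) (fun j => val (y (k j))) s := cvg0_sub kj ys.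
have gcvg := aut_div_dcvg sa sb.
have sg : lift s (aut_comp a (aut_sym b)).
  by apply: (lift_closed HD yks gcvg) => j; have [] := gst j.
have Is : I s by apply/iso_scalings_lift; exists (aut_comp a (aut_sym b)).
exists (exist _ s (mem_set Is)).
apply: (dcauchy_sub_dcvg scaling_dist_pseudo kj yc).
apply: (le_cvg0 _ (cvg0D gcvg yks)) => j /=.
rewrite (pdist_ge0 scaling_dist_pseudo)/= lerD2r.
have [_ yj _] := gst j.
(* The quotient of the [j]-th lift by the limit lift lies over [y (k j) / s]; by right invariance
   its distance to the identity is that of the two lifts. *)
apply: (le_trans (lift_norm_le (lift_mul yj (lift_inv sg)))).
rewrite (le_trans _ (wdist_le_aut HD _ _))//.
by rewrite -[leRHS]wdist_id_div.
Qed.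

End completeness.

End scaling_metric.

(** Centres of balls of radius [2^-1 ^+ n] that belong to the filter form a Cauchy sequence, and the
    filter converges to its limit. *)
Lemma complete_metric_seq (R : realType) (M : metricType R) :
  dcomplete (@mdist R M) -> complete_metric M.
Proof.
move=> cM F FF /cauchyP Fc.
have pM : pseudo_dist (@mdist R M).
  by split=> *; [exact: mdistxx|exact: metric_sym|exact: metric_triangle].
have [x Fx] := choice (fun n => Fc _ (exprhalf_gt0 n)).
have xx m n : mdist (x m) (x n) < 2^-1 ^+ m + 2^-1 ^+ n.
  have : F (ball (x m) (2^-1 ^+ m) `&` ball (x n) (2^-1 ^+ n)) by exact: filterI.
  move=> /filter_ex[y []]; rewrite !ballEmdist /= => my ny.
  by rewrite (le_lt_trans (metric_triangle _ y _))// ltrD// metric_sym.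
have [l xl] : exists l, dcvg (@mdist R M) x l.
  apply: cM; apply: (dcauchy_exprhalf pM (C := 2)) => n.
  rewrite (le_trans (ltW (xx _ _)))// mulrDl mul1r lerD2l ler_exprhalf//.
exists l; apply/cvg_ballP => e e0.
have e2 : 0 < e / 2 by rewrite divr_gt0.
have [N HN] := (dcvgP pM _ _).1 xl _ e2.
have [K HK] := exprhalf_lt e2.
pose n := maxn N K; apply: filterS (Fx n) => y; rewrite !ballEmdist /= => ny.
rewrite (le_lt_trans (metric_triangle _ (x n) _))// [e]splitr ltrD//.
  by rewrite metric_sym HN// leq_maxl.
by rewrite (lt_trans ny)// (le_lt_trans _ HK)// ler_exprhalf// leq_maxr.
Qed.

(** * The Polish group topology *)

Section polish_topology.
Context {d : measure_display} {X : measurableType d} {R : realType}.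
Variables (P : probability X R) (T : flow P).
Variables (D : X -> X -> R) (z : nat -> X).
Hypothesis HD : polish_dist D z.

Notation dist := (@scaling_dist _ _ _ _ T D z).

Lemma scaling_dist_complete : dcomplete dist.
Proof. by move=> y yc; exact: (scaling_dist_cvg HD yc). Qed.

(** Forgetting the automorphism is a 1-Lipschitz surjection from the graph of lifts, so it sends a
    dense sequence to a dense one. *)
Lemma scaling_dist_dense : exists y, ddense dist y.
Proof.
pose w1 : lift_graph T setT := exist _ (1%g, aut_id P) (lift1 T (J := setT)).
have [w dw] := small_codes_ddense w1 (lift_dist_small_codes T HD setT).
have Iw k : iso_scalings T (sval (w k)).1.
  by apply/iso_scalings_lift; exists (sval (w k)).2; exact: (svalP (w k)).
exists (fun k => exist _ (sval (w k)).1 (mem_set (Iw k)) : scaling_group T) => x e e0.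
have [S xS] := (iso_scalings_lift T _).1 (scaling_iso x).
have [k Hk] := dw (exist _ (val x, S) xS) e e0; exists k.
apply: le_lt_trans Hk; rewrite /lift_dist /scaling_dist /= addrC lerD2l.
apply: (le_trans (lift_norm_le HD (lift_mul (svalP (w k)) (lift_inv xS)))).
rewrite (le_trans _ (wdist_le_aut HD _ _))//.
by rewrite -[leRHS](wdist_id_div HD).
Qed.

Lemma ler_scaling_dist (x y : scaling_group T) : rdist (val x) (val y) <= dist x y.
Proof. by rewrite lerDr (lift_norm_ge0 HD)//; exact: scaling_div_iso. Qed.

Lemma scaling_dist_eq0 (x y : scaling_group T) : dist x y = 0 -> x = y.
Proof.
move=> xy; apply/val_inj/rdist_eq0/eqP; rewrite eq_le (pdist_ge0 (@rdist_pseudo R)) andbT.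
by rewrite -xy ler_scaling_dist.
Qed.

Lemma scaling_distV (x y : scaling_group T) : dist x^-1%g y^-1%g = dist x y.
Proof.
rewrite [RHS](pdistC (scaling_dist_pseudo T HD)) /scaling_dist; congr (_ + _).
  congr lift_norm; apply: val_inj; rewrite /= invrK; exact: mulrC.
rewrite [RHS](pdistC (@rdist_pseudo R)).
by rewrite /rdist /= !invrK addrC.
Qed.

(** The [lift_norm] part is subadditive, but [rdist] is not invariant under multiplication. The
    factor comes from [p q - p' q' = p (q - q') + (p - p') q'], and so involves [x] and [y']. *)
Lemma scaling_distM (x y x' y' : scaling_group T) :
  dist (x * y)%g (x' * y')%g <=
  (dist x x' + dist y y') * (1 + `|val (val x)| + `|(val (val x))^-1| +
     `|val (val y')| + `|(val (val y'))^-1|).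
Proof.
have N0 (u v : scaling_group T) : 0 <= lift_norm T D z (val u * (val v)^-1)%g.
  by by apply: (lift_norm_ge0 HD); exact: scaling_div_iso.
have NM : lift_norm T D z (val (x * y) * (val (x' * y'))^-1)%g <=
    lift_norm T D z (val x * (val x')^-1)%g + lift_norm T D z (val y * (val y')^-1)%g.
  rewrite (_ : (val (x * y) * _)%g = (val x * (val x')^-1) * (val y * (val y')^-1))%g.
    by apply: (lift_normM HD); exact: scaling_div_iso.
  apply: val_inj => /=; rewrite invfM; ring.
rewrite /scaling_dist.
move: (N0 x x') (N0 y y') NM.
set n1 := lift_norm _ _ _ _; set n2 := lift_norm _ _ _ _; set n := lift_norm _ _ _ _.
move=> n10 n20 nn; rewrite /rdist /= !invfM.
set a := val (val x); set b := val (val y); set a' := val (val x'); set b' := val (val y').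
have h (p q p' q' : R) : `|p * q - p' * q'| <= `|p| * `|q - q'| + `|p - p'| * `|q'|.
  rewrite (_ : p * q - p' * q' = p * (q - q') + (p - p') * q'); last by ring.
  by rewrite -!normrM ler_normD.
have h1 := h a b a' b'.
have h2 := h a^-1 b^-1 a'^-1 b'^-1.
move: (normr_ge0 a) (normr_ge0 a^-1) (normr_ge0 b') (normr_ge0 b'^-1).
move: (normr_ge0 (a - a')) (normr_ge0 (b - b')).
move: (normr_ge0 (a^-1 - a'^-1)) (normr_ge0 (b^-1 - b'^-1)).
move: h1 h2.
move: (`|a|) (`|a^-1|) (`|b'|) (`|b'^-1|) (`|a - a'|) (`|b - b'|) (`|a^-1 - a'^-1|)
  (`|b^-1 - b'^-1|) => A A' B B' p q r w h1 h2 r0 w0 p0 q0 A0 A'0 B0 B'0.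
have k0 : 0 <= A + A' + B + B' by lra.
have m0 := mulr_ge0 (addr_ge0 n10 n20) k0.
have m1 : A * q <= A * (p + q + r + w) by apply: ler_wpM2l => //; lra.
have m2 : p * B <= (p + q + r + w) * B by apply: ler_wpM2r => //; lra.
have m3 : A' * w <= A' * (p + q + r + w) by apply: ler_wpM2l => //; lra.
have m4 : r * B' <= (p + q + r + w) * B' by apply: ler_wpM2r => //; lra.
lra.
Qed.

(** A copy that can carry the new metric, as [scaling_group T] already has the induced topology. The
    dummy [let] makes [HD] a parameter of the type, from which the instance recovers the
    distance. *)
Definition scaling_space : Type := let _ := HD in scaling_group T.

HB.instance Definition _ := Choice.copy scaling_space (scaling_group T).

HB.instance Definition _ := isMetric.Build R scaling_space
  (pdistxx (scaling_dist_pseudo T HD)) scaling_dist_eq0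
  (pdistC (scaling_dist_pseudo T HD)) (pdist_tri (scaling_dist_pseudo T HD)).

Lemma scaling_ball (x : scaling_space) e : ball x e = [set y : scaling_space | dist x y < e].
Proof. exact: ballEmdist. Qed.

Lemma scaling_space_finer (U : set (scaling_group T)) : open U ->
  @open scaling_space U.
Proof.
move=> [V [W oW WV] VU]; rewrite openE => x Ux.
have Wx : W (val (val x)).
  by move: Ux; rewrite -VU /= -WV.
have /nbhs_ballP[e /= e0 He] : nbhs (val (val x)) W by apply: open_nbhs_nbhs.
apply/nbhs_ballP; exists e => // y; rewrite scaling_ball /= => xy.
rewrite -VU /= -WV; apply: He; rewrite /ball /=.
apply: le_lt_trans xy; apply: le_trans (ler_scaling_dist x y).
exact: ler_rdist.
Qed.

Lemma scaling_space_mul_continuous :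
  continuous (fun w : scaling_space * scaling_space =>
    ((w.1 : scaling_group T) * (w.2 : scaling_group T))%g : scaling_space).
Proof.
move=> [x y]; apply/cvg_ballP => e e0.
(* [K] bounds the factor of [scaling_distM] near [y]: the two added units allow for [y'] at distance
   less than 1. *)
pose K := 1 + `|val (val x)| + `|(val (val x))^-1| + (`|val (val y)| + 1) +
  (`|(val (val y))^-1| + 1).
have K0 : 0 < K.
  rewrite /K; move: (normr_ge0 (val (val x))) (normr_ge0 (val (val x))^-1).
  by move: (normr_ge0 (val (val y))) (normr_ge0 (val (val y))^-1); lra.
pose r := Num.min 1 (e / (2 * K)).
have r0 : 0 < r by rewrite lt_min ltr01 divr_gt0// mulr_gt0.
exists (ball x r, ball y r); first by split; exact: nbhsx_ballx.
move=> [x' y'] /= []; rewrite !scaling_ball /= => xx yy.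
have y'K : 1 + `|val (val x)| + `|(val (val x))^-1| + `|val (val y')| +
    `|(val (val y'))^-1| <= K.
  have : rdist (val y) (val y') < 1.
    by rewrite (le_lt_trans (ler_scaling_dist y y'))// (lt_le_trans yy)// ge_min lexx.
  rewrite /rdist /K.
  have := ler_distD (val (val y)) 0 (val (val y')); rewrite !sub0r !normrN.
  have := ler_distD (val (val y))^-1 0 (val (val y'))^-1; rewrite !sub0r !normrN.
  move: (normr_ge0 (val (val y) - val (val y'))).
  move: (normr_ge0 ((val (val y))^-1 - (val (val y'))^-1)); lra.
have rK : r * (2 * K) <= e.
  by rewrite -ler_pdivlMr ?mulr_gt0// /r ge_min lexx orbT.
have xy : dist x x' + dist y y' < 2 * r by rewrite mulrDl !mul1r ltrD.
have xy0 : 0 <= dist x x' + dist y y'.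
  by rewrite addr_ge0// (pdist_ge0 (scaling_dist_pseudo T HD)).
apply: (le_lt_trans (scaling_distM x y x' y')).
apply: (le_lt_trans (ler_wpM2l xy0 y'K)).
apply: lt_le_trans rK; rewrite mulrA [r * 2]mulrC ltr_pM2r//.
Qed.

Lemma scaling_space_inv_continuous :
  continuous (fun x : scaling_space => ((x : scaling_group T)^-1)%g : scaling_space).
Proof.
move=> x; have xF := nbhs_filter (x : scaling_space).
apply/cvg_ballP => e e0; apply: filterS (nbhsx_ballx (x : scaling_space) e e0) => y.
by rewrite !scaling_ball /= scaling_distV.
Qed.

Lemma scaling_space_polish : polish_space R scaling_space.
Proof.
split; last first.
  exists scaling_space; split.
    exact: (@complete_metric_seq _ scaling_space scaling_dist_complete).
  by exists id, id; split => // x; exact: cvg_id.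
have [y dy] := scaling_dist_dense.
exists (range (y : nat -> scaling_space)); first exact: card_image_le.
move=> U [x Ux] oU.
have /nbhs_ballP[e /= e0 He] : nbhs x U by apply: open_nbhs_nbhs.
have [k Hk] := dy x e e0; exists (y k); split; last by exists k.
apply: He; rewrite scaling_ball /=.
by rewrite (pdistC (scaling_dist_pseudo T HD)).
Qed.

End polish_topology.

Theorem proposition1p3 (R : realType) (d : measure_display)
    (X : measurableType d) (P : probability X R) (T : flow P) :
  standard_borel X R -> nonatomic P -> ergodic_flow T -> free_flow T ->
  (borel (Rstar R) (iso_scalings T) /\ borel (Rstar R) (iso_times T)) /\
  (exists tau : topology (scaling_group T),
     [/\ finer_topology tau,
         polish_space R (with_topology tau) &
         group_topology tau]).
Proof.
move=> sX _ _ _.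
have [x0 _] : [set: X] !=set0.
  apply/set0P/eqP => X0; have := probability_setT P.
  by rewrite X0 measure0 => /eqP; rewrite eq_sym onee_eq0.
have [D [z HD]] := standard_borel_dist x0 sX.
split; first split.
- rewrite (_ : iso_scalings T = [set s | exists S, lift T setT s S]).
    exact: (lift_borel T HD).
  by apply/seteqP; split=> s /iso_scalings_lift.
- rewrite (_ : iso_times T = [set s | exists S, lift T [set 1] s S]).
    exact: (lift_borel T HD).
  by apply/seteqP; split=> s /iso_times_lift.
exists (Topological.class (scaling_space T HD)); split.
- exact: scaling_space_finer.
- exact: scaling_space_polish.
- split; [exact: scaling_space_mul_continuous|exact: scaling_space_inv_continuous].
Qed.
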